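(* Let $\mathbb{K}$ be an algebraically closed field of characteristic zero and let $H$ be a finite dimensional pointed Hopf algebra over $\mathbb{K}$ with group of group-like elements $G(H)$. If the order $|G(H)|$ is odd, then $H$ is almost involutive. In particular, if $\dim_{\mathbb{K}} H$ is odd, then $H$ is almost involutive.
   Context: For a Hopf algebra $H$ with comultiplication $\Delta$ and antipode $\mathcal{S}$: a nonzero element $g\in H$ is group-like if $\Delta(g)=g\otimes g$, and $G(H)$ denotes the group of group-like elements. $H$ is pointed if its only simple subcoalgebras are the one-dimensional ones. $H$ is almost involutive if there exists a Hopf algebra automorphism $\sigma:H\to H$ (called a companion automorphism) such that $\sigma^2=\mathcal{S}^2$. *)

(* Defs.v *)
From HB Require Import structures.
From mathcomp Require Import all_boot all_order all_algebra all_field.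
From mathcomp Require Import finmap boolp classical_sets cardinality.

Set Implicit Arguments.
Unset Strict Implicit.
Unset Printing Implicit Defensive.

Import GRing.Theory.
Local Open Scope ring_scope.

Reserved Notation "u *t v" (at level 40, left associativity).

(* Tensor products of finite-dimensional vector spaces, in coordinates: a
   tensor is the matrix of its coefficients on the products of the vectors of
   the standard bases.  [tlift_tens] and [tens_lfunP] are the existence and
   uniqueness parts of the universal property. *)

Section Tensor.
Variable K : fieldType.
Implicit Types U V W : vectType K.

Definition tensor U V : vectType K := 'M[K]_(\dim {:U}, \dim {:V}).

Definition tens U V (u : U) (v : V) : tensor U V :=
  \matrix_(i, j) (coord (vbasis {:U}) i u * coord (vbasis {:V}) j v).

(* The linear map sending u *t v to f u v; meaningful for f bilinear. *)
Definition tlift U V W (f : U -> V -> W) : 'Hom(tensor U V, W) :=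
  linfun (fun M : 'M[K]_(\dim {:U}, \dim {:V}) =>
    \sum_i \sum_j M i j *: f (vbasis {:U})`_i (vbasis {:V})`_j).

End Tensor.

Notation "u *t v" := (tens u v) : ring_scope.

Section TensorTheory.
Variable K : fieldType.
Implicit Types U V W : vectType K.

Lemma tliftE U V W (f : U -> V -> W) (M : tensor U V) :
  tlift f M = \sum_i \sum_j M i j *: f (vbasis {:U})`_i (vbasis {:V})`_j.
Proof.
pose g (M : 'M[K]_(\dim {:U}, \dim {:V})) : W :=
  \sum_i \sum_j M i j *: f (vbasis {:U})`_i (vbasis {:V})`_j.
have gl : linear g.
  move=> a x y; rewrite /g scaler_sumr -big_split; apply: eq_bigr => i _ /=.
  rewrite scaler_sumr -big_split; apply: eq_bigr => j _ /=.
  by rewrite !mxE scalerDl scalerA.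
pose gL := GRing.isLinear.Build K _ W _ g gl.
pose g' : {linear 'M[K]_(\dim {:U}, \dim {:V}) -> W} := HB.pack g gL.
exact: (lfunE g' M).
Qed.

Lemma tens_linearl U V (v : V) : linear (fun u : U => u *t v).
Proof.
by move=> a x y; apply/matrixP=> i j; rewrite !mxE linearP mulrDl mulrA.
Qed.

Lemma tens_linearr U V (u : U) : linear (fun v : V => u *t v).
Proof.
move=> a x y; apply/matrixP=> i j.
by rewrite !mxE linearP mulrDr !mulrA [a * _]mulrC.
Qed.

Lemma tlift_tens U V W (f : U -> V -> W) :
  (forall v, linear (f^~ v)) -> (forall u, linear (f u)) ->
  forall u v, tlift f (u *t v) = f u v.
Proof.
move=> fl fr u v; rewrite tliftE.
pose gl y : {linear U -> W} :=
  HB.pack (f^~ y) (GRing.isLinear.Build K U W _ (f^~ y) (fl y)).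
pose gr x : {linear V -> W} :=
  HB.pack (f x) (GRing.isLinear.Build K V W _ (f x) (fr x)).
rewrite [in RHS](coord_vbasis (memvf u)) -[RHS]/(gl v _) linear_sum.
apply: eq_bigr => i _; rewrite linearZ /= -[f _ v]/(gr _ v).
rewrite [in RHS](coord_vbasis (memvf v)) linear_sum scaler_sumr.
by apply: eq_bigr => j _; rewrite linearZ /= mxE scalerA.
Qed.

Lemma tens_sum U V (M : tensor U V) :
  M = \sum_i \sum_j M i j *: ((vbasis {:U})`_i *t (vbasis {:V})`_j).
Proof.
rewrite [LHS]matrix_sum_delta; apply: eq_bigr => i _; apply: eq_bigr => j _.
congr (_ *: _); apply/matrixP=> k l; rewrite !mxE.
rewrite !coord_free ?(basis_free (vbasisP _)) // -natrM mulnb.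
by rewrite !(eq_sym _ k, eq_sym _ l).
Qed.

Lemma tens_lfunP U V W (f g : 'Hom(tensor U V, W)) :
  (forall u v, f (u *t v) = g (u *t v)) -> f = g.
Proof.
move=> fg; apply/lfunP=> M; rewrite [M]tens_sum !linear_sum.
apply: eq_bigr => i _; rewrite !linear_sum; apply: eq_bigr => j _.
by rewrite !linearZ /= fg.
Qed.

End TensorTheory.

Section TensorMaps.
Variable K : fieldType.
Implicit Types U V W : vectType K.

Definition tmap U V U' V' (f : 'Hom(U, U')) (g : 'Hom(V, V')) :
    'Hom(tensor U V, tensor U' V') :=
  tlift (fun u v => f u *t g v).

Definition tassoc U V W :
    'Hom(tensor (tensor U V) W, tensor U (tensor V W)) :=
  tlift (fun x w => tlift (fun u v => u *t (v *t w)) x).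

(* C (x) D as a subspace of U (x) V *)
Definition tensv U V (C : {vspace U}) (D : {vspace V}) : {vspace tensor U V} :=
  <<[seq u *t v | u <- vbasis C, v <- vbasis D]>>%VS.

Lemma tmapE U V U' V' (f : 'Hom(U, U')) (g : 'Hom(V, V')) u v :
  tmap f g (u *t v) = f u *t g v.
Proof.
apply: tlift_tens => [y|x] a b c; rewrite linearP.
  exact: tens_linearl.
exact: tens_linearr.
Qed.

Lemma tassocE U V W (u : U) (v : V) (w : W) :
  tassoc U V W ((u *t v) *t w) = u *t (v *t w).
Proof.
have E (z : W) x y : tlift (fun (u : U) (v : V) => u *t (v *t z)) (x *t y) =
    x *t (y *t z).
  rewrite tlift_tens // => [y' | x'] a b c; first exact: tens_linearl.
  by rewrite tens_linearl tens_linearr.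
rewrite /tassoc tlift_tens // => [y | x] a b c; first by rewrite linearP.
rewrite !tliftE scaler_sumr -big_split; apply: eq_bigr => i _ /=.
rewrite scaler_sumr -big_split; apply: eq_bigr => j _ /=.
rewrite !tens_linearr scalerDr !scalerA.
by rewrite [a * _]mulrC.
Qed.

Variables A B : falgType K.

Definition tmul (x y : tensor A B) : tensor A B :=
  tlift (fun a b => tlift (fun a' b' => (a * a') *t (b * b')) y) x.

Definition lmul : 'Hom(tensor A A, A) := tlift (fun x y : A => x * y).

Lemma lmulE x y : lmul (x *t y) = x * y.
Proof.
apply: tlift_tens => [z|z] a b c; first by rewrite mulrDl scalerAl.
by rewrite mulrDr scalerAr.
Qed.

Lemma tmulE a b a' b' : tmul (a *t b) (a' *t b') = (a * a') *t (b * b').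
Proof.
have E x y x' y' :
    tlift (fun a' b' => (x * a') *t (y * b')) (x' *t y') = (x * x') *t (y * y').
  rewrite tlift_tens // => [u|u] k v w.
    by rewrite mulrDr -scalerAr tens_linearl.
  by rewrite mulrDr -scalerAr tens_linearr.
rewrite /tmul tlift_tens => [|u|u] /=; first exact: E.
  by move=> k v w; rewrite !E mulrDl -scalerAl tens_linearl.
by move=> k v w; rewrite !E mulrDl -scalerAl tens_linearr.
Qed.

End TensorMaps.

HB.mixin Record Vector_isCoalgebra (K : fieldType) C of Vector K C := {
  comul : 'Hom(C, tensor C C);
  counit : 'Hom(C, K^o);
  comulA : forall x,
    tassoc C C C (tmap comul \1%VF (comul x)) = tmap \1%VF comul (comul x);
  counitl : forall x, tlift (fun y z => counit y *: z) (comul x) = x;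
  counitr : forall x, tlift (fun y z => counit z *: y) (comul x) = x
}.

#[short(type="coalgType")]
HB.structure Definition Coalgebra (K : fieldType) :=
  { C of Vector_isCoalgebra K C & Vector K C }.

HB.mixin Record Coalgebra_isBialgebra (K : fieldType) H
    of Coalgebra K H & Falgebra K H := {
  comul1 : comul (1 : H) = 1 *t 1 :> tensor H H;
  comulM : forall x y : H, comul (x * y) = tmul (comul x) (comul y);
  counit1 : counit (1 : H) = 1 :> K;
  counitM : forall x y : H, counit (x * y) = counit x * counit y :> K
}.

#[short(type="bialgType")]
HB.structure Definition Bialgebra (K : fieldType) :=
  { H of Coalgebra_isBialgebra K H & Coalgebra K H & Falgebra K H }.

HB.mixin Record Bialgebra_isHopf (K : fieldType) H of Bialgebra K H := {
  antipode : 'End(H);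
  antipodel : forall x : H,
    lmul H (tmap antipode \1%VF (comul x)) = (counit x : K)%:A;
  antipoder : forall x : H,
    lmul H (tmap \1%VF antipode (comul x)) = (counit x : K)%:A
}.

#[short(type="hopfAlgType")]
HB.structure Definition HopfAlgebra (K : fieldType) :=
  { H of Bialgebra_isHopf K H & Bialgebra K H }.

Section CoalgebraDefs.
Variables (K : fieldType) (H : coalgType K).

Definition grouplike (g : H) : bool := (g != 0) && (comul g == g *t g).

Definition subcoalgebra (C : {vspace H}) : bool :=
  (comul @: C <= tensv C C)%VS.

Definition simple_subcoalgebra (C : {vspace H}) : Prop :=
  [/\ subcoalgebra C, C != 0%VS &
      forall D : {vspace H}, subcoalgebra D -> (D <= C)%VS ->
        D = 0%VS \/ D = C].

Definition pointed : Prop :=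
  forall C : {vspace H}, simple_subcoalgebra C -> \dim C = 1%N.

Definition grouplike_set : set H := [set g | grouplike g]%classic.

(* The order of G(H).  [fset_set] is a default value on infinite sets, but
   [finite_grouplike_set] shows that this case does not arise. *)
Definition grouplike_order : nat := #|` fset_set grouplike_set|%fset.

Lemma grouplike_free (s : seq H) : uniq s -> all grouplike s -> free s.
Proof.
elim: s => [|g s IHs] /=; first by rewrite nil_free.
case/andP=> gs us /andP[gg gls]; have fs := IHs us gls.
rewrite free_cons fs andbT; apply/negP => g_in.
pose c i := coord (in_tuple s) i.
pose phi i j : 'Hom(tensor H H, K^o) :=
  tlift (fun u v : H => c i u * c j v : K^o).
have phiE i j u v : phi i j (u *t v) = c i u * c j v.
  rewrite /phi tlift_tens // => [w|w] a x y.
    by rewrite /c linearP /= mulrDl -mulrA.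
  by rewrite /c linearP /= mulrDr mulrCA.
have gE : g = \sum_i c i g *: s`_i.
  by rewrite {1}(coord_span (X := in_tuple s) g_in).
have cE (i j : 'I_(size s)) : c i s`_j = (i == j)%:R.
  by rewrite /c (coord_free (X := in_tuple s)) // eq_sym.
have comulE (i : 'I_(size s)) : comul s`_i = s`_i *t s`_i.
  by have /allP/(_ _ (mem_nth 0 (ltn_ord i)))/andP[_ /eqP] := gls.
case/andP: gg => g0 /eqP Dg.
have cc i j : c i g * c j g = (i == j)%:R * c i g.
  rewrite -phiE -Dg {1}gE !linear_sum /=.
  under eq_bigr => k _ do rewrite !linearZ /= comulE phiE !cE.
  rewrite (bigD1 i) //= eqxx big1 ?addr0 => [|k ki]; last first.
    by rewrite eq_sym (negPf ki) mul0r scaler0.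
  by rewrite mul1r /GRing.scale /= mulrC eq_sym.
have [i ci0] : exists i, c i g != 0.
  apply/existsP; apply: contraNT g0; rewrite negb_exists => /forallP c0.
  by rewrite gE big1 // => i _; move/negPn/eqP: (c0 i) => ->; rewrite scale0r.
have ci1 : c i g = 1.
  by apply: (mulfI ci0); rewrite cc eqxx mulrC.
case/negP: gs; rewrite gE (bigD1 i) //= ci1 scale1r big1 ?addr0 ?mem_nth //.
move=> j ji; suff -> : c j g = 0 by rewrite scale0r.
by apply: (mulfI ci0); rewrite cc eq_sym (negPf ji) mul0r mulr0.
Qed.

Lemma finite_grouplike_set : finite_set grouplike_set.
Proof.
apply: contrapT => /(infinite_set_fset (\dim {:H}).+1) [X XG].
have fX : free X.
  by apply: grouplike_free; [exact: fset_uniq | apply/allP => g /XG].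
by rewrite ltnNge -(eqnP fX) dimvS ?subvf.
Qed.

Lemma grouplike_orderP (s : seq H) :
  uniq s -> s =i grouplike -> size s = grouplike_order.
Proof.
move=> us sG; rewrite /grouplike_order.
have /(uniq_perm us (fset_uniq _))/perm_size -> // : s =i fset_set grouplike_set.
move=> g; rewrite (in_fset_set finite_grouplike_set) sG.
by apply/idP/idP; rewrite inE.
Qed.

End CoalgebraDefs.

Arguments pointed {K} H.
Arguments grouplike_order {K} H.

Section HopfDefs.
Variable K : fieldType.

Definition hopf_morphism (H H' : hopfAlgType K) (f : 'Hom(H, H')) : Prop :=
  [/\ ahom_in {:H} f,
      forall x, comul (f x) = tmap f f (comul x),
      forall x, counit (f x) = counit x &
      forall x, f (antipode x) = antipode (f x)].

Definition hopf_automorphism (H : hopfAlgType K) (f : 'End(H)) : Prop :=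
  hopf_morphism f /\ bijective f.

Definition almost_involutive (H : hopfAlgType K) : Prop :=
  exists2 sigma : 'End(H), hopf_automorphism sigma &
    (sigma \o sigma)%VF = (antipode \o antipode)%VF.

End HopfDefs.

(* Main.v *)
From HB Require Import structures.
Require Import Defs.
From mathcomp Require Import all_boot all_order all_fingroup all_algebra.
From mathcomp Require Import all_solvable all_field.
From mathcomp Require Import boolp finmap cardinality zify.
From mathcomp Require classical_sets.

(** Let phi be the square of the antipode S, let N be the order of G(H), and let
J be the ideal of the dual algebra of H made of the functionals that vanish on
G(H).

Pointedness means that the simple comodules are the lines spanned by
group-likes ([coideal_quotient_eigen]). Hence J is nilpotent ([killed_dim]): the
coradical filtration, whose term H_n is the orthogonal of J^(n+1) and whose
bottom term H_0 is the span of G(H), exhausts H.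

The map phi is a Hopf algebra endomorphism that fixes G(H). Modulo H_0, an
element of H_1 is a sum of elements y such that Delta(y) is congruent to
g (x) y + y (x) h modulo H_0 (x) H_0, with g and h group-like. For such a y the
defining identity of the antipode gives S(y) = - g^-1 y h^-1 modulo H_0, and
applying S once more gives phi(y) = c y d modulo H_0 with c = h g^-1 and
d = h^-1 g in G(H) ([sqantipode_skew]). As c^N = d^N = 1, the map U = phi^N
is the identity on H_0 and on H_1 / H_0. The powers of J are products of
elements of J, so U - 1 sends each H_n into H_(n-1) ([endo_sub_killed]), and U
is unipotent ([iter_sqantipode_unipotent]).

In characteristic zero the binomial series, which is here a finite sum, defines
U^t for every t in K ([unipow]). For a fixed argument, each identity which says
that U^t is a morphism of Hopf algebras is polynomial in t, and it holds for all
natural numbers t; so it holds for all t ([hopf_morphism_unipow]). If N is odd,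
sigma = phi^((N+1)/2) U^(-1/2) is then a Hopf algebra automorphism, and
sigma^2 = phi^(N+1) U^(-1) = phi.

The case of odd dimension reduces to the previous one, because N divides the
dimension of H ([grouplike_order_dvd_dim]): H has a filtration by left coideals
stable under left multiplication by G(H) whose successive quotients have
dimension N. *)

Set Implicit Arguments.
Unset Strict Implicit.
Unset Printing Implicit Defensive.

Import GRing.Theory.
Local Open Scope ring_scope.

(** * Linear maps out of a tensor product *)

Section Sweedler.
Variable K : fieldType.
Implicit Types U V W : vectType K.

Definition bilin U V W (F : U -> V -> W) :=
  (forall v, linear (F^~ v)) /\ (forall u, linear (F u)).

Lemma linfunE U V (f : U -> V) : linear f ->
  forall u, f u = linfun f u.
Proof.
move=> fl u; pose g : {linear U -> V} :=
  HB.pack f (GRing.isLinear.Build K U V _ f fl).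
by rewrite -[f]/(g : U -> V) lfunE.
Qed.

Lemma linear_bigsum U V (f : U -> V) : linear f ->
  forall I (r : seq I) P (F : I -> U),
  f (\sum_(i <- r | P i) F i) = \sum_(i <- r | P i) f (F i).
Proof.
move=> fl I r P F; rewrite (linfunE fl) linear_sum.
by apply: eq_bigr => i _; exact/esym/linfunE.
Qed.

Lemma linear_scale U V (f : U -> V) : linear f -> forall k u, f (k *: u) = k *: f u.
Proof. by move=> fl k u; rewrite !(linfunE fl) linearZ. Qed.

Lemma lfun_linear U V (f : 'Hom(U, V)) : linear f.
Proof. by move=> a x y; rewrite linearP. Qed.

Lemma bilin_comp U V U' V' W (F : U -> V -> W) (f : 'Hom(U', U)) (g : 'Hom(V', V)) :
  bilin F -> bilin (fun a b => F (f a) (g b)).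
Proof.
by case=> Fl Fr; split=> [v|u] a x y; rewrite linearP ?Fl ?Fr.
Qed.

Lemma bilin_lfun U V W W' (F : U -> V -> W) (h : 'Hom(W, W')) :
  bilin F -> bilin (fun a b => h (F a b)).
Proof.
by case=> Fl Fr; split=> [v|u] a x y; rewrite ?Fl ?Fr linearP.
Qed.

Lemma tens_bilin U V : bilin (fun (u : U) (v : V) => u *t v).
Proof. by split=> [v|u]; [exact: tens_linearl | exact: tens_linearr]. Qed.

Lemma tlift_bilin U V W (F : U -> V -> W) u v : bilin F -> tlift F (u *t v) = F u v.
Proof. by case=> Fl Fr; apply: tlift_tens. Qed.

Lemma eq_tlift U V W (F G : U -> V -> W) t :
  (forall u v, F u v = G u v) -> tlift F t = tlift G t.
Proof.
move=> FG; rewrite !tliftE; apply: eq_bigr => i _; apply: eq_bigr => j _.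
by rewrite FG.
Qed.

Lemma tlift_lin U V W W' (F : U -> V -> W) (h : W -> W') t :
  linear h -> h (tlift F t) = tlift (fun u v => h (F u v)) t.
Proof.
move=> hl; rewrite !tliftE linear_bigsum //; apply: eq_bigr => i _.
by rewrite linear_bigsum //; apply: eq_bigr => j _; rewrite linear_scale.
Qed.

Lemma tlift_param U V W W' (F : W' -> U -> V -> W) t :
  (forall u v, linear (fun w => F w u v)) -> linear (fun w => tlift (F w) t).
Proof.
move=> Fl a x y; rewrite !tliftE scaler_sumr -big_split; apply: eq_bigr => i _ /=.
rewrite scaler_sumr -big_split; apply: eq_bigr => j _ /=.
by rewrite Fl scalerDr !scalerA [a * _]mulrC.
Qed.

Lemma tlift_tmap U V U' V' W (F : U -> V -> W) (f : 'Hom(U', U)) (g : 'Hom(V', V)) t :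
  bilin F -> tlift F (tmap f g t) = tlift (fun a b => F (f a) (g b)) t.
Proof.
move=> Fb; rewrite -comp_lfunE; congr (fun_of_lfun _ t); apply: tens_lfunP => u v.
by rewrite comp_lfunE tmapE !tlift_bilin //; apply: bilin_comp.
Qed.

Lemma tmap_tlift U V U' V' (f : 'Hom(U, U')) (g : 'Hom(V, V')) t :
  tmap f g t = tlift (fun u v => f u *t g v) t.
Proof. by []. Qed.

Lemma tliftK U V (t : tensor U V) : tlift (fun u v => u *t v) t = t.
Proof. by rewrite tliftE [RHS]tens_sum. Qed.

Lemma slicel_tens U V (f : 'Hom(U, K^o)) (u : U) (v : V) :
  tlift (fun a b => (f a : K) *: b) (u *t v) = (f u : K) *: v.
Proof.
apply: tlift_bilin; split=> [y|x] k a b;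
  by rewrite ?linearP /= ?scalerDl ?scalerDr ?scalerA // mulrC.
Qed.

Lemma slicer_tens U V (f : 'Hom(V, K^o)) (u : U) (v : V) :
  tlift (fun a b => (f b : K) *: a) (u *t v) = (f v : K) *: u.
Proof.
apply: tlift_bilin; split=> [y|x] k a b;
  by rewrite ?linearP /= ?scalerDl ?scalerDr ?scalerA // mulrC.
Qed.

End Sweedler.

(** * Coassociativity in Sweedler form *)

Section Coassociativity.
Variables (K : fieldType) (C : coalgType K).
Implicit Types W : vectType K.

Definition trilin W (F : C -> C -> C -> W) :=
  [/\ forall b c, linear (fun a => F a b c), forall a c, linear (fun b => F a b c)
    & forall a b, linear (fun c => F a b c)].

(** In Sweedler notation, with x mapping to x1 (x) x2 (x) x3, both sides are the sum
of the F x1 x2 x3: each is the value at (Delta (x) id) Delta x, respectively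
(id (x) Delta) Delta x, of a linear map on a triple tensor product, and the two
linear maps correspond to each other under the associativity isomorphism. *)
Lemma sweedlerA W (F : C -> C -> C -> W) (x : C) : trilin F ->
  tlift (fun y c => tlift (fun a b => F a b c) (comul y)) (comul x) =
  tlift (fun a y => tlift (fun b c => F a b c) (comul y)) (comul x).
Proof.
case=> F1 F2 F3.
pose G := tlift (fun (t : tensor C C) c => tlift (fun a b => F a b c) t).
pose G' := tlift (fun a (t : tensor C C) => tlift (fun b c => F a b c) t).
have Gb : bilin (fun (t : tensor C C) c => tlift (fun a b => F a b c) t).
  by split=> [c|t]; [exact: lfun_linear | apply: tlift_param].
have G'b : bilin (fun a (t : tensor C C) => tlift (fun b c => F a b c) t).
  by split=> [c|t]; [apply: tlift_param | exact: lfun_linear].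
have GG t : G t = G' (tassoc C C C t).
  rewrite -comp_lfunE; congr (fun_of_lfun _ t); apply: tens_lfunP => u c.
  rewrite comp_lfunE /G tlift_bilin //.
  rewrite -[LHS]/(tlift _ u).
  pose h : 'Hom(tensor C C, W) := (G' \o tassoc C C C \o linfun (fun t => t *t c))%VF.
  have hE t' : h t' = G' (tassoc C C C (t' *t c)).
    by rewrite /h !comp_lfunE -linfunE //; apply: tens_linearl.
  rewrite -hE; congr (fun_of_lfun _ u); apply: tens_lfunP => a b.
  by rewrite hE tassocE /G' !tlift_bilin //; split.
have := congr1 G' (comulA x); rewrite -GG /G /G' !tlift_tmap // => E.
by apply: etrans (etrans _ E) _; apply: eq_tlift => a b /=; rewrite id_lfunE.
Qed.

End Coassociativity.

(** * Convolution and the antipode *)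

Section Convolution.
Variables (K : fieldType) (C : coalgType K) (B : vectType K).
Variable mu : B -> B -> B.
Hypothesis mu_bilin : bilin mu.

(** The product of the convolution algebra Hom(C, B). The target is a vector space
with an arbitrary bilinear product, so that Hom(C, B) may itself serve as a
target. *)
Definition conv (f g : 'Hom(C, B)) : 'Hom(C, B) :=
  (tlift (fun a b => mu (f a) (g b)) \o comul)%VF.

Definition conv_unit (e : B) : 'Hom(C, B) := linfun (fun x : C => (counit x : K) *: e).

Lemma convE f g x : conv f g x = tlift (fun a b => mu (f a) (g b)) (comul x).
Proof. by rewrite comp_lfunE. Qed.

Lemma conv_unitE e x : conv_unit e x = (counit x : K) *: e.
Proof.
rewrite -[LHS]linfunE // => a u v.
by rewrite linearP /= scalerDl scalerA.
Qed.

Lemma conv_bilin : bilin conv.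
Proof.
case: mu_bilin => mul mur; split=> [g|f] a x y; apply/lfunP => u.
  rewrite add_lfunE scale_lfunE !convE.
  rewrite -(tlift_param (F := fun f a b => mu ((f : 'Hom(C, B)) a) (g b))) //.
  by move=> u' v k f f'; rewrite add_lfunE scale_lfunE mul.
rewrite add_lfunE scale_lfunE !convE.
rewrite -(tlift_param (F := fun g a b => mu (f a) ((g : 'Hom(C, B)) b))) //.
by move=> u' v k g g'; rewrite add_lfunE scale_lfunE mur.
Qed.

Lemma conv_trilin (f g h : 'Hom(C, B)) :
  trilin (fun a b c : C => mu (f a) (mu (g b) (h c))).
Proof.
by case: mu_bilin => mul mur; split=> [b c|a c|a b] k x y;
  rewrite lfun_linear ?mul ?mur ?mul ?mur.
Qed.

Lemma conv_assoc : associative mu -> associative conv.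
Proof.
move=> muA f g h; apply/lfunP => x; rewrite !convE; case: mu_bilin => mul mur.
transitivity (tlift (fun a y =>
    tlift (fun b c => mu (f a) (mu (g b) (h c))) (comul y)) (comul x)).
  by apply: eq_tlift => a b; rewrite convE (tlift_lin _ _ (h := mu (f a))).
rewrite -sweedlerA; last exact: conv_trilin.
apply: eq_tlift => y c; rewrite convE (tlift_lin _ _ (h := mu^~ (h c))) //.
by apply: eq_tlift => a b; rewrite muA.
Qed.

Lemma conv_unitl e f : left_id e mu -> conv (conv_unit e) f = f.
Proof.
move=> mu1; apply/lfunP => x; rewrite convE -[in RHS](counitl x).
rewrite tlift_lin; last exact: lfun_linear.
apply: eq_tlift => a b; rewrite conv_unitE linearZ /=.
by rewrite (linear_scale (f := mu^~ (f b))) ?mu1 //; case: mu_bilin.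
Qed.

Lemma conv_unitr e f : right_id e mu -> conv f (conv_unit e) = f.
Proof.
move=> mu1; apply/lfunP => x; rewrite convE -[in RHS](counitr x).
rewrite tlift_lin; last exact: lfun_linear.
apply: eq_tlift => a b; rewrite conv_unitE linearZ /=.
by rewrite (linear_scale (f := mu (f a))) ?mu1 //; case: mu_bilin.
Qed.

(** A left and a right convolution inverse of the same map coincide. The identities
of the antipode on products and coproducts are instances of this. *)
Lemma conv_inv_uniq e f g h : associative mu -> left_id e mu -> right_id e mu ->
  conv f g = conv_unit e -> conv g h = conv_unit e -> f = h.
Proof.
move=> muA mu1 m1u fg gh.
by rewrite -[f](conv_unitr _ m1u) -gh conv_assoc // fg conv_unitl.
Qed.

End Convolution.

Section Curry.
Variables (K : fieldType) (U V W : vectType K).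

Definition curry (F : U -> V -> W) : 'Hom(U, 'Hom(V, W)) := linfun (fun u => linfun (F u)).

Lemma curryE F u v : bilin F -> curry F u v = F u v.
Proof.
case=> Fl Fr; rewrite -linfunE; first by rewrite -linfunE.
move=> a x y; apply/lfunP => w; rewrite add_lfunE scale_lfunE -!linfunE //.
exact: Fl.
Qed.

End Curry.

Section Antipode.
Variables (K : fieldType) (H : hopfAlgType K).
Local Notation S := (antipode : 'End(H)).
Local Notation eps x := (counit x : K).

Lemma mul_bilin (A : falgType K) : bilin (fun x y : A => x * y).
Proof.
split=> [v|u] a x y; first by rewrite mulrDl scalerAl.
by rewrite mulrDr scalerAr.
Qed.

Lemma lmul_tmap (f g : 'End(H)) t : lmul H (tmap f g t) = tlift (fun a b => f a * g b) t.
Proof. by rewrite tlift_tmap //; apply: mul_bilin. Qed.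

Lemma antipodeSl x : tlift (fun a b : H => S a * b) (comul x) = (eps x)%:A.
Proof.
by rewrite -antipodel lmul_tmap; apply: eq_tlift => a b; rewrite id_lfunE.
Qed.

Lemma antipodeSr x : tlift (fun a b : H => a * S b) (comul x) = (eps x)%:A.
Proof.
by rewrite -antipoder lmul_tmap; apply: eq_tlift => a b; rewrite id_lfunE.
Qed.

(** Apply the counit to S(x1) x2 = eps(x) 1 and use its multiplicativity. *)
Lemma counit_antipode x : counit (S x) = counit x.
Proof.
have := congr1 counit (antipodeSl x).
rewrite linearZ /= counit1 [X in _ = X]mulr1 => <-.
rewrite [RHS]tlift_lin; last exact: lfun_linear.
rewrite -{1}(counitr x) !tlift_lin; try exact: lfun_linear.
by apply: (@eq_tlift _ _ _ K^o) => a b; rewrite counitM !linearZ /= mulrC.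
Qed.

Lemma antipode1 : S 1 = 1.
Proof.
have := antipodeSl 1; rewrite comul1 tlift_bilin ?counit1 ?scale1r ?mulr1 //.
by split=> [v|u] a x y; rewrite ?linearP ?mulrDl ?mulrDr -?scalerAl -?scalerAr.
Qed.

(** Read as maps of the two arguments x and y, S (x y) is a left inverse and S y * S x
a right inverse of the multiplication for the convolution product of
Hom(H, Hom(H, H)), where the inner Hom is itself a convolution algebra. *)
Lemma antipodeM x y : S (x * y) = S y * S x.
Proof.
pose mu := @conv K H H (fun a b => a * b).
have mub : bilin mu by exact/conv_bilin/mul_bilin.
have muA : associative mu by apply: conv_assoc; [exact: mul_bilin | exact: mulrA].
pose e := conv_unit H (1 : H).
have mu1 : left_id e mu by move=> f; apply: conv_unitl; [exact: mul_bilin | exact: mul1r].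
have m1u : right_id e mu by move=> f; apply: conv_unitr; [exact: mul_bilin | exact: mulr1].
pose M := curry (fun a b : H => a * b).
have Mb := mul_bilin H.
have fb : bilin (fun a b : H => S (a * b)) by apply: bilin_lfun.
have gb : bilin (fun a b : H => S b * S a).
  by case: Mb => ml mr; split=> [v|u] k a b;
    rewrite linearP ?ml ?mr ?mulrDl ?mulrDr -?scalerAl -?scalerAr.
suff E : curry (fun a b : H => S (a * b)) = curry (fun a b : H => S b * S a).
  by rewrite -[LHS](curryE _ _ fb) E curryE.
apply: (conv_inv_uniq mub (g := M) (e := e)) => //.
  (* S(x1 y1) x2 y2 = S((x y)1) (x y)2 = eps(x y) 1 *)
  apply/lfunP => {}x; apply/lfunP => {}y; rewrite convE conv_unitE scale_lfunE conv_unitE.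
  rewrite (tlift_lin _ _ (h := fun f : 'Hom(H, H) => f y)); last first.
    by move=> k f g; rewrite add_lfunE scale_lfunE.
  rewrite scalerA -counitM -antipodeSl comulM /tmul.
  rewrite !(tlift_lin _ _ (lfun_linear _)); apply: eq_tlift => a b /=.
  rewrite !(tlift_lin _ _ (lfun_linear _)) convE; apply: eq_tlift => c d /=.
  rewrite !curryE // tlift_bilin //.
  by split=> [v|u] k a' b'; rewrite ?linearP ?mulrDl ?mulrDr -?scalerAl -?scalerAr.
(* x1 y1 S(y2) S(x2) = eps(x) eps(y) 1 *)
apply/lfunP => {}x; apply/lfunP => {}y; rewrite convE conv_unitE scale_lfunE conv_unitE.
rewrite (tlift_lin _ _ (h := fun f : 'Hom(H, H) => f y)); last first.
  by move=> k f g; rewrite add_lfunE scale_lfunE.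
rewrite scalerA mulrC -scalerA -antipodeSr (tlift_lin _ _ (h := *:%R _)); last first.
  by move=> k a b; rewrite scalerDr !scalerA mulrC.
apply: eq_tlift => a b; rewrite convE.
transitivity (a * tlift (fun c d : H => c * S d) (comul y) * S b); last first.
  by rewrite antipodeSr -scalerAr mulr1 -scalerAl.
rewrite (tlift_lin _ _ (h := fun z => a * z * S b)); last first.
  by move=> k z z'; rewrite mulrDr mulrDl -scalerAr -scalerAl.
by apply: eq_tlift => c d; rewrite !curryE // !mulrA.
Qed.

End Antipode.

(** * The tensor square as an algebra, and the antipode as an anti-coalgebra map *)

Section TensorAlgebra.
Variables (K : fieldType).

Lemma tens_ext (U V W : vectType K) (f g : tensor U V -> W) :
  linear f -> linear g -> (forall u v, f (u *t v) = g (u *t v)) -> f =1 g.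
Proof.
move=> fl gl fg t; rewrite (linfunE fl) (linfunE gl).
by congr (fun_of_lfun _ t); apply: tens_lfunP => u v; rewrite -!linfunE.
Qed.

Variables (A B : falgType K).

Lemma tmul_bilin : bilin (@tmul K A B).
Proof.
split=> [v|u]; first exact: lfun_linear.
rewrite /tmul; apply: tlift_param => a b; exact: lfun_linear.
Qed.

Lemma tmulA : associative (@tmul K A B).
Proof.
move=> x y z; case: tmul_bilin => ml mr; move: x y z.
have A1 (a : A) (b : B) y z : tmul (a *t b) (tmul y z) = tmul (tmul (a *t b) y) z.
  move: y; apply: (tens_ext (f := fun y => tmul (a *t b) (tmul y z))
    (g := fun y => tmul (tmul (a *t b) y) z)) => [k u v|k u v|c d]; rewrite ?ml ?mr ?ml //.
  move: z; apply: (tens_ext (f := fun z => tmul (a *t b) (tmul (c *t d) z))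
    (g := fun z => tmul (tmul (a *t b) (c *t d)) z)) => [k u v|k u v|c' d']; rewrite ?ml ?mr //.
  by rewrite !tmulE !mulrA.
move=> x y z; move: x.
apply: (tens_ext (f := fun x => tmul x (tmul y z))
    (g := fun x => tmul (tmul x y) z)) => [k u v|k u v|a b] //; by rewrite !ml.
Qed.

Lemma tmul1l : left_id (1 *t 1) (@tmul K A B).
Proof.
case: tmul_bilin => ml mr.
apply: (tens_ext (f := fun x => tmul (1 *t 1) x) (g := fun x => x)) => // a b.
by rewrite tmulE !mul1r.
Qed.

Lemma tmul1r : right_id (1 *t 1) (@tmul K A B).
Proof.
case: tmul_bilin => ml mr.
apply: (tens_ext (f := fun x => tmul x (1 *t 1)) (g := fun x => x)) => // a b.
by rewrite tmulE !mulr1.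
Qed.

End TensorAlgebra.

Section AntipodeCoalgebra.
Variables (K : fieldType) (H : hopfAlgType K).
Local Notation S := (antipode : 'End(H)).

(** In the convolution algebra Hom(H, H (x) H), the map Delta S is a left inverse of
Delta and the right-hand side is a right inverse of it. *)
Lemma antipode_comul (x : H) :
  comul (S x) = tlift (fun a b => S b *t S a) (comul x).
Proof.
have sb : bilin (fun a b : H => S b *t S a).
  by split=> [v|u] k a b; rewrite linearP ?tens_linearl ?tens_linearr.
have tb := tmul_bilin H H; have [ml mr] := tb.
pose f : 'Hom(H, tensor H H) := (comul \o S)%VF.
pose h : 'Hom(H, tensor H H) := (tlift (fun a b => S b *t S a) \o comul)%VF.
suff E : f = h by rewrite -[LHS]comp_lfunE -/f E comp_lfunE.
apply: (conv_inv_uniq tb (g := comul) (e := 1 *t 1));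
  [exact: tmulA | exact: tmul1l | exact: tmul1r | |];
  apply/lfunP => {}x; rewrite convE conv_unitE.
  rewrite -comul1 -linearZ -antipodeSl /= [RHS]tlift_lin; last exact: lfun_linear.
  by apply: eq_tlift => a b; rewrite comulM comp_lfunE.
(* x1 S(x4) (x) x2 S(x3) = x1 S(x2) (x) 1 = eps(x) (1 (x) 1), after regrouping
   the inner factors x2 and x3 *)
pose F y z a b : tensor H H := (y * S b) *t (z * S a).
have Fl : forall z a b, linear (fun y => F y z a b).
  by move=> z a b k u v; rewrite /F mulrDl -scalerAl tens_linearl.
have F2 : forall y a b, linear (fun z => F y z a b).
  by move=> y a b k u v; rewrite /F mulrDl -scalerAl tens_linearr.
have F3 : forall y z b, linear (fun a => F y z a b).
  by move=> y z b k u v; rewrite /F linearP mulrDr -scalerAr tens_linearr.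
have F4 : forall y z a, linear (fun b => F y z a b).
  by move=> y z a k u v; rewrite /F linearP mulrDr -scalerAr tens_linearl.
have Fb y z : bilin (F y z) by split.
transitivity (tlift (fun p q =>
    tlift (fun a b => tlift (F a b) (comul q)) (comul p)) (comul x)).
  apply: eq_tlift => p q; rewrite /h comp_lfunE.
  rewrite -{1}[comul p]tliftK (tlift_lin _ _ (h := fun t => tmul t _)); last exact: ml.
  apply: eq_tlift => a b; rewrite (tlift_lin _ _ (h := tmul _)); last exact: mr.
  by apply: eq_tlift => c d; rewrite tmulE.
rewrite (sweedlerA (F := fun a b q => tlift (F a b) (comul q))); last first.
  split=> [b c|a c|a b].
  - by apply: tlift_param.
  - by apply: tlift_param.
  - by move=> k u v; rewrite !linearP.
transitivity (tlift (fun a y => (a * S y) *t (1 : H)) (comul x)); last first.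
  rewrite -(tlift_lin _ _ (h := fun z => z *t (1 : H))); last exact: tens_linearl.
  by rewrite antipodeSr (linear_scale (f := fun z => z *t (1 : H))) //; apply: tens_linearl.
apply: eq_tlift => a y.
rewrite -(sweedlerA (F := fun b c d => F a b c d)); last by split.
rewrite -[in RHS](counitl y).
rewrite (tlift_lin _ _ (h := fun y => (a * S y) *t (1 : H))); last first.
  by move=> k u v; rewrite linearP mulrDr -scalerAr tens_linearl.
apply: eq_tlift => p d.
rewrite /F -(tlift_lin _ _ (h := fun z => (a * S d) *t z)); last first.
  exact: tens_linearr.
rewrite antipodeSr (linear_scale (f := fun z => (a * S d) *t z)); last exact: tens_linearr.
rewrite -(linear_scale (f := fun z => z *t (1 : H))); last exact: tens_linearl.
by rewrite linearZ -scalerAr.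
Qed.

End AntipodeCoalgebra.

(** * Duality and subspaces of tensor products *)

Section LinearAlgebra.
Variables (K : fieldType).
Implicit Types U V : vectType K.

Lemma ex_min_vspace V (P : {vspace V} -> Prop) :
  (exists W, P W) ->
  exists2 W, P W & forall W', P W' -> (W' <= W)%VS -> W' = W.
Proof.
case=> W0; have [n le_n] := ubnP (\dim W0); elim: n W0 le_n => // n IHn W0 le_n P0.
have [[W1 P1 [W10 neq]]|no] := EM (exists2 W1, P W1 & (W1 <= W0)%VS /\ W1 <> W0).
  apply: IHn P1; rewrite -ltnS; apply: leq_trans le_n; rewrite ltnS.
  rewrite ltn_neqAle dimvS // andbT; apply/negP => /eqP E; apply: neq.
  by apply/eqP; rewrite eqEdim W10 E leqnn.
exists W0 => // W' P' le'; apply: contrapT => neq; apply: no; by exists W'.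
Qed.

Definition coordf V n (X : n.-tuple V) (i : 'I_n) : 'Hom(V, K^o) :=
  linfun (coord X i : V -> K^o).

Lemma coordfE V n (X : n.-tuple V) i v : coordf X i v = coord X i v.
Proof. by rewrite lfunE. Qed.

(** Project along W and take a nonzero coordinate of what remains of x. *)
Lemma dual_sep V (W : {vspace V}) x : x \notin W ->
  exists f : 'Hom(V, K^o), (forall w, w \in W -> f w = 0) /\ f x = 1.
Proof.
move=> xW; pose y := x - projv W x.
have y0 : y != 0.
  by apply: contraNneq xW => /eqP; rewrite subr_eq0 => /eqP ->; rewrite memv_proj.
have [i yi] : exists i, coord (vbasis {:V}) i y != 0.
  apply/existsP; apply: contraNT y0; rewrite negb_exists => /forallP c0.
  rewrite (coord_vbasis (memvf y)) big1 // => i _.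
  by move/negPn/eqP: (c0 i) => ->; rewrite scale0r.
exists ((coord (vbasis {:V}) i y)^-1 *: (coordf (vbasis {:V}) i \o (\1 - projv W))%VF).
split=> [w wW|]; rewrite scale_lfunE comp_lfunE add_lfunE opp_lfunE id_lfunE coordfE.
  by rewrite projv_id // subrr linear0 scaler0.
by rewrite -/y; apply: mulVf.
Qed.

Lemma dual_eq0 V (x : V) : (forall f : 'Hom(V, K^o), f x = 0) -> x = 0.
Proof.
move=> fx; apply/eqP; rewrite -memv0; apply: contraT => /dual_sep [f [_]].
by rewrite fx => /eqP; rewrite eq_sym oner_eq0.
Qed.

Lemma memv_tensv U V (C : {vspace U}) (D : {vspace V}) u v :
  u \in C -> v \in D -> u *t v \in tensv C D.
Proof.
move=> uC vD; rewrite (coord_vbasis uC) (linear_bigsum (tens_linearl v)).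
rewrite memv_suml // => i _.
rewrite (linear_scale (tens_linearl v)) memvZ // (coord_vbasis vD).
rewrite (linear_bigsum (tens_linearr _)) memv_suml // => j _.
rewrite (linear_scale (tens_linearr _)) memvZ // memv_span //; apply/allpairsP.
by exists ((vbasis C)`_i, (vbasis D)`_j); rewrite !mem_nth ?size_tuple.
Qed.

Lemma tensv_img U V (W : vectType K) (C : {vspace U}) (D : {vspace V}) (E : {vspace W})
    (h : 'Hom(tensor U V, W)) :
  (forall u v, u \in C -> v \in D -> h (u *t v) \in E) ->
  forall t, t \in tensv C D -> h t \in E.
Proof.
move=> hE t /(memv_img h); apply/subvP; rewrite limg_span.
apply/span_subvP => _ /mapP[_ /allpairsP[[u v] /= [uC vD ->] ->]].
by apply: hE; apply: vbasis_mem.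
Qed.

(** Writing t as a sum of e_i (x) y_i over a basis, each y_i is a slice of t; so the
hypotheses say that id (x) p and q (x) id fix t, where p and q project onto D
and C, and then t = (q (x) p) t lies in C (x) D. *)
Lemma tensv_slices U V (C : {vspace U}) (D : {vspace V}) (t : tensor U V) :
  (forall f : 'Hom(U, K^o), tlift (fun a b => (f a : K) *: b) t \in D) ->
  (forall f : 'Hom(V, K^o), tlift (fun a b => (f b : K) *: a) t \in C) ->
  t \in tensv C D.
Proof.
move=> tD tC.
have cE (W : vectType K) (i k : 'I_(\dim {:W})) :
    coord (vbasis {:W}) i (vbasis {:W})`_k = (i == k)%:R.
  by rewrite coord_free ?(basis_free (vbasisP _)) // eq_sym.
have rowD i : \sum_j t i j *: (vbasis {:V})`_j \in D.
  have := tD (coordf (vbasis {:U}) i); rewrite tliftE (bigD1 i) //= [X in _ + X]big1 ?addr0.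
    congr (_ \in D); apply: eq_bigr => j _.
    by rewrite coordfE cE eqxx scale1r.
  move=> k ki; rewrite big1 // => j _; rewrite coordfE cE eq_sym (negPf ki).
  by rewrite scale0r scaler0.
have colC j : \sum_i t i j *: (vbasis {:U})`_i \in C.
  have := tC (coordf (vbasis {:V}) j); rewrite tliftE.
  congr (_ \in C); apply: eq_bigr => i _; rewrite (bigD1 j) //= [X in _ + X]big1 ?addr0.
    by rewrite coordfE cE eqxx scale1r.
  move=> k ki; rewrite coordfE cE eq_sym (negPf ki).
  by rewrite scale0r scaler0.
have tmp1 : tmap \1%VF (projv D) t = t.
  rewrite tmap_tlift tliftE [RHS]tens_sum; apply: eq_bigr => i _.
  transitivity ((vbasis {:U})`_i *t projv D (\sum_j t i j *: (vbasis {:V})`_j)); last first.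
    rewrite projv_id // (linear_bigsum (tens_linearr _)).
    by apply: eq_bigr => j _; rewrite (linear_scale (tens_linearr _)).
  rewrite linear_sum (linear_bigsum (tens_linearr _)); apply: eq_bigr => j _.
  by rewrite linearZ (linear_scale (tens_linearr _)) id_lfunE.
have tmp2 : tmap (projv C) \1%VF t = t.
  rewrite tmap_tlift tliftE [RHS]tens_sum exchange_big [RHS]exchange_big.
  apply: eq_bigr => j _ /=.
  transitivity (projv C (\sum_i t i j *: (vbasis {:U})`_i) *t (vbasis {:V})`_j); last first.
    rewrite projv_id // (linear_bigsum (tens_linearl _)).
    by apply: eq_bigr => i _; rewrite (linear_scale (tens_linearl _)).
  rewrite linear_sum (linear_bigsum (tens_linearl _)); apply: eq_bigr => i _.
  by rewrite linearZ (linear_scale (tens_linearl _)) id_lfunE.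
rewrite -tmp2 -tmp1 [tmap (projv C) _ _]tlift_tmap; last first.
  exact: (bilin_comp _ _ (tens_bilin _ _)).
rewrite tliftE memv_suml // => i _; rewrite memv_suml // => j _.
by rewrite memvZ // !id_lfunE memv_tensv // memv_proj.
Qed.

End LinearAlgebra.

(** * The two actions of the dual algebra on a coalgebra *)

Section DualAction.
Variables (K : fieldType) (C : coalgType K).
Local Notation dual := 'Hom(C, K^o).
Implicit Types (f g : dual) (x : C).

(** The product of the dual algebra: (f g)(x) = f(x1) g(x2). *)
Definition dmul f g : dual := conv (fun a b : K^o => a * b) f g.

(** x is sent to f(x1) x2. This is a right action of the dual algebra; the stable
subspaces are the left coideals. *)
Definition Lact f : 'End(C) := (tlift (fun a b => (f a : K) *: b) \o comul)%VF.

(** x is sent to x1 f(x2), a left action which commutes with [Lact]. *)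
Definition Ract f : 'End(C) := (tlift (fun a b => (f b : K) *: a) \o comul)%VF.

Lemma LactE f x : Lact f x = tlift (fun a b => (f a : K) *: b) (comul x).
Proof. exact: comp_lfunE. Qed.

Lemma RactE f x : Ract f x = tlift (fun a b => (f b : K) *: a) (comul x).
Proof. exact: comp_lfunE. Qed.

Lemma dmulE f g x : dmul f g x = tlift (fun a b : C => f a * g b : K^o) (comul x).
Proof. exact: convE. Qed.

Lemma dmulA : associative dmul.
Proof. by apply: conv_assoc; [exact: mul_bilin | exact: mulrA]. Qed.

Lemma counit_conv_unit : counit = conv_unit C (1 : K^o).
Proof. by apply/lfunP => x; rewrite conv_unitE; apply/esym/mulr1. Qed.

Lemma dmul1l f : dmul counit f = f.
Proof. by rewrite counit_conv_unit; apply: conv_unitl; [exact: mul_bilin | exact: mul1r]. Qed.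

Lemma dmul1r f : dmul f counit = f.
Proof. by rewrite counit_conv_unit; apply: conv_unitr; [exact: mul_bilin | exact: mulr1]. Qed.

Lemma Lact1 x : Lact counit x = x.
Proof. by rewrite LactE counitl. Qed.

Lemma Ract1 x : Ract counit x = x.
Proof. by rewrite RactE counitr. Qed.

Lemma Lact_lin x : linear (Lact^~ x).
Proof.
move=> k f g; rewrite !LactE.
rewrite -(tlift_param (F := fun (f : dual) a b => (f a : K) *: (b : C))) // => a b k' u v.
by rewrite add_lfunE scale_lfunE scalerDl scalerA.
Qed.

Lemma Ract_lin x : linear (Ract^~ x).
Proof.
move=> k f g; rewrite !RactE.
rewrite -(tlift_param (F := fun (f : dual) (a b : C) => (f b : K) *: (a : C))) // => a b k' u v.
by rewrite add_lfunE scale_lfunE scalerDl scalerA.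
Qed.

Lemma LactB f g x : Lact (f - g) x = Lact f x - Lact g x.
Proof. by rewrite addrC -scaleN1r (Lact_lin x) scaleN1r addrC. Qed.

Lemma RactB f g x : Ract (f - g) x = Ract f x - Ract g x.
Proof. by rewrite addrC -scaleN1r (Ract_lin x) scaleN1r addrC. Qed.

Lemma dual_Lact f g x : g (Lact f x) = dmul f g x.
Proof.
rewrite LactE dmulE (tlift_lin _ _ (lfun_linear g)).
by apply: (@eq_tlift _ _ _ K^o) => a b; rewrite linearZ.
Qed.

Lemma dual_Ract f g x : g (Ract f x) = dmul g f x.
Proof.
rewrite RactE dmulE (tlift_lin _ _ (lfun_linear g)).
by apply: (@eq_tlift _ _ _ K^o) => a b; rewrite linearZ /= mulrC.
Qed.

Lemma dual_ext (x y : C) : (forall f : dual, f x = f y) -> x = y.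
Proof.
move=> E; apply/eqP; rewrite -subr_eq0; apply/eqP/dual_eq0 => f.
by rewrite linearB /= E subrr.
Qed.

Lemma Lact_comp f g x : Lact f (Lact g x) = Lact (dmul g f) x.
Proof. by apply: dual_ext => h; rewrite !dual_Lact dmulA. Qed.

Lemma Ract_comp f g x : Ract f (Ract g x) = Ract (dmul f g) x.
Proof. by apply: dual_ext => h; rewrite !dual_Ract dmulA. Qed.

Lemma LRact f g x : Lact f (Ract g x) = Ract g (Lact f x).
Proof. by apply: dual_ext => h; rewrite !(dual_Ract, dual_Lact) dmulA. Qed.

Lemma grouplikeP (g : C) : grouplike g -> g != 0 /\ comul g = g *t g.
Proof. by case/andP=> ? /eqP. Qed.

Lemma Lact_grouplike f (g : C) : grouplike g -> Lact f g = (f g : K) *: g.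
Proof.
by case/grouplikeP=> _ cg; rewrite LactE cg slicel_tens.
Qed.

Lemma counit_grouplike (g : C) : grouplike g -> counit g = 1.
Proof.
move=> gg; have /eqP := Lact_grouplike counit gg; rewrite Lact1.
rewrite -[X in X == _](scale1r g) -subr_eq0 -scalerBl scaler_eq0 subr_eq0.
by case/andP: gg => /negPf -> _; rewrite orbF eq_sym => /eqP.
Qed.

Definition Lstable (W : {vspace C}) := forall f x, x \in W -> Lact f x \in W.
Definition Rstable (W : {vspace C}) := forall f x, x \in W -> Ract f x \in W.

Lemma stable_subcoalgebra W : Lstable W -> Rstable W -> subcoalgebra W.
Proof.
move=> LW RW; apply/subvP => _ /memv_imgP[x xW ->]; apply: tensv_slices => f.
  by rewrite -LactE LW.
by rewrite -RactE RW.
Qed.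

(** A generator x satisfies Delta(x) = a (x (x) x), and counitality forces
a eps(x) = 1, so that a x is group-like. *)
Lemma subcoalgebra_dim1 (D : {vspace C}) : subcoalgebra D -> \dim D = 1%N ->
  exists2 g : C, grouplike g & g \in D.
Proof.
move=> sD dD; pose x := vpick D.
have D0 : D != 0%VS by rewrite -dimv_eq0 dD.
have x0 : x != 0 by rewrite vpick0.
have xD : x \in D by apply: memv_pick.
have DE : D = <[x]>%VS.
  by apply/esym/eqP; rewrite eqEdim -memvE xD dim_vline x0 dD.
have : comul x \in <[x *t x]>%VS.
  rewrite -[comul x]id_lfunE; apply: (tensv_img (C := D) (D := D)); last first.
    by move/subvP: sD; apply; apply: memv_img.
  move=> u v; rewrite DE => /vlineP[a ->] /vlineP[b ->]; rewrite id_lfunE.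
  by rewrite (linear_scale (tens_linearl _)) (linear_scale (tens_linearr _)) !memvZ // memv_line.
case/vlineP=> a cx.
have ax : (a * (counit x : K)) *: x = x.
  by rewrite -[RHS]Lact1 LactE cx linearZ -scalerA /= slicel_tens.
have a0 : a != 0 by apply: contraNneq x0 => a0; rewrite -ax a0 mul0r scale0r.
exists (a *: x); last by rewrite memvZ.
rewrite /grouplike scaler_eq0 negb_or a0 x0 /= linearZ /= cx.
by rewrite (linear_scale (tens_linearl _)) (linear_scale (tens_linearr _)).
Qed.

Lemma Lstable_preim W V f : Lstable V -> Lstable W -> Lstable (V :&: Ract f @^-1: W).
Proof.
move=> LV LW h x; rewrite !memv_cap -!memv_preim => /andP[xV xW].
by rewrite LV //= -LRact LW.
Qed.

Lemma Lstable_sumR (V : {vspace C}) (fs : seq dual) : Lstable V ->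
  Lstable (\sum_(f <- fs) (Ract f @: V))%VS.
Proof.
move=> LV h x; elim: fs x => [|f fs IH] x.
  by rewrite !big_nil !memv0 => /eqP ->; rewrite linear0.
rewrite !big_cons => /memv_addP[_ /memv_imgP[u uV ->] [v vW ->]].
by rewrite linearD /= LRact memv_add ?IH // memv_img // LV.
Qed.

Hypothesis pointedC : pointed C.

(** Let V be a simple left coideal. Right slices are morphisms of comodules, so the
sum of the R_f V is a sum of copies of V. Adding these summands one at a time,
the first R_f V that makes the sum contain g meets the preceding sum W
trivially, and g = R_f v + c with c in W. Since g determines v, the eigenvector
equations of g pass to v, and these equations make v a multiple of g. *)
Lemma coideal_grouplike_aux V (g : C) (fs : seq dual) : Lstable V ->
  (forall W, Lstable W -> (W <= V)%VS -> W = 0%VS \/ W = V) ->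
  grouplike g -> g \in (\sum_(f <- fs) (Ract f @: V))%VS -> g \in V.
Proof.
move=> LV minV gg; have [g0 _] := grouplikeP gg.
elim: fs => [|f fs IH]; first by rewrite big_nil memv0 (negPf g0).
rewrite big_cons; set W := (\sum_(f <- fs) _)%VS in IH *.
have LW : Lstable W by apply: Lstable_sumR.
case/memv_addP=> _ /memv_imgP[v vV ->] [c cW gE].
case: (minV _ (Lstable_preim (f := f) LV LW) (capvSl _ _)) => kE; last first.
  apply: IH; rewrite gE memvD // memv_preim.
  by move: vV; rewrite -{1}kE memv_cap => /andP[].
have Lv h : Lact h v = (h g : K) *: v.
  apply/eqP; rewrite -subr_eq0 -memv0 -kE memv_cap memvB ?memvZ ?LV //= -memv_preim.
  rewrite linearB linearZ /= -LRact.
  have -> : Ract f v = g - c by rewrite gE addrK.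
  rewrite linearB /= (Lact_grouplike _ gg) scalerBr opprB addrC addrA subrK.
  by rewrite memvB ?memvZ ?LW.
have vE : v = (counit v : K) *: g.
  apply: dual_ext => h; rewrite -[in LHS](dmul1r h) -dual_Lact Lv !linearZ /=.
  exact: mulrC.
have [c0|c0] := eqVneq (counit v : K) 0.
  by apply: IH; rewrite gE vE c0 scale0r linear0 add0r.
by rewrite -[g]scale1r -(mulVf c0) -scalerA -vE memvZ.
Qed.

(** The right slices of a simple left coideal W span a subcoalgebra. It contains a
simple subcoalgebra, which is the line of a group-like element by pointedness,
and the previous lemma places this element in W. *)
Lemma coideal_grouplike V : Lstable V -> V != 0%VS -> exists2 g : C, grouplike g & g \in V.
Proof.
move=> LV V0.
have [] := @ex_min_vspace _ _ (fun W => [/\ Lstable W, W != 0%VS & (W <= V)%VS]).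
  by exists V.
move=> {V0 LV} W [LW W0 WV] minW.
have {}minW : forall W', Lstable W' -> (W' <= W)%VS -> W' = 0%VS \/ W' = W.
  move=> W' LW' le'; case: (eqVneq W' 0%VS) => [->|W'0]; first by left.
  by right; apply: minW => //; split=> //; apply: subv_trans WV.
(* Finitely many functionals suffice to span all the slices of W *)
pose fs := [seq coordf (vbasis {:C}) i | i <- enum 'I_(\dim {:C})].
pose D := (\sum_(f <- fs) (Ract f @: W))%VS.
have DR f x : x \in W -> Ract f x \in D.
  move=> xW.
  have -> : f = \sum_(i < \dim {:C})
      (f (vbasis {:C})`_i : K) *: coordf (vbasis {:C}) i.
    apply/lfunP => y; rewrite {1}(coord_vbasis (memvf y)) linear_sum sum_lfunE.
    by apply: eq_bigr => i _; rewrite linearZ scale_lfunE coordfE /= [LHS]mulrC.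
  rewrite (linear_bigsum (@Ract_lin x)) memv_suml // => i _.
  rewrite (linear_scale (@Ract_lin x)) memvZ //.
  rewrite /D big_map big_enum /= (bigD1 i) //=.
  by rewrite -[Ract _ _]addr0 memv_add ?mem0v ?memv_img.
have DP x : x \in D -> forall P : C -> Prop, P 0 ->
    (forall f u v, u \in W -> P v -> P (Ract f u + v)) -> P x.
  move=> + P P0 PD; rewrite /D; elim: (fs) x => [|f fs' IH] x.
    by rewrite big_nil memv0 => /eqP ->.
  rewrite big_cons => /memv_addP[_ /memv_imgP[u uV ->] [v vW ->]].
  by apply: PD => //; apply: IH.
have LD : Lstable D by apply: Lstable_sumR.
have RD : Rstable D.
  move=> f x xD; apply: (DP x xD (fun x => Ract f x \in D)); first by rewrite linear0 mem0v.
  by move=> h u v uW vD; rewrite linearD /= Ract_comp memvD // DR.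
have WD : (W <= D)%VS by apply/subvP => x xW; rewrite -[x]Ract1 DR.
have [] := @ex_min_vspace _ _ (fun E => [/\ subcoalgebra E, E != 0%VS & (E <= D)%VS]).
  exists D; split=> //; first exact: stable_subcoalgebra.
  by apply: contraNneq W0 => D0; move: WD; rewrite D0 subv0.
move=> E [sE E0 ED] minE.
have [|g gg gE] := subcoalgebra_dim1 sE.
  apply: pointedC; split=> // E' sE' le'; case: (eqVneq E' 0%VS) => [->|E'0]; first by left.
  by right; apply: minE => //; split=> //; apply: subv_trans ED.
exists g => //; apply: (subvP WV); apply: (coideal_grouplike_aux (fs := fs)) => //.
exact: (subvP ED).
Qed.

(** The quotient of C by a proper left coideal W contains a line on which the dual
acts through a group-like. Take V minimal among the left coideals not contained
in W, and a functional l that kills W but not V. Then R_l embeds V / (V meet W)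
as a left coideal of C, where a group-like g can be found; v is its preimage. *)
Lemma coideal_quotient_eigen W : Lstable W -> W != {:C}%VS ->
  exists v (g : C), [/\ v \notin W, grouplike g
    & forall f, Lact f v - (f g : K) *: v \in W].
Proof.
move=> LW Wf.
have [] := @ex_min_vspace _ _ (fun V => Lstable V /\ ~~ (V <= W)%VS).
  exists {:C}%VS; split; first by move=> f x _; apply: memvf.
  by apply: contraNN Wf; rewrite eqEsubv subvf.
move=> V [LV VW] minV.
have [x xV xW] := subvPn VW.
have [l [lW lx]] := dual_sep xW.
have RW w : w \in W -> Ract l w = 0.
  by move=> wW; apply: dual_ext => f; rewrite dual_Ract -dual_Lact lW ?LW // linear0.
have LRV : Lstable (Ract l @: V)%VS.
  by move=> f _ /memv_imgP[u uV ->]; rewrite LRact memv_img ?LV.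
have [|g gg /memv_imgP[v vV gE]] := coideal_grouplike LRV.
  apply/eqP => R0; have : Ract l x \in (Ract l @: V)%VS by apply: memv_img.
  rewrite R0 memv0 => /eqP/(congr1 counit); rewrite dual_Ract dmul1l lx linear0 => /eqP.
  by rewrite oner_eq0.
have [g0 _] := grouplikeP gg.
have vW : v \notin W by apply: contra g0 => /RW; rewrite -gE => ->.
exists v, g; split=> // f.
have LZ : Lstable (0%VS : {vspace C}).
  by move=> h y; rewrite !memv0 => /eqP ->; rewrite linear0.
pose U := (V :&: Ract l @^-1: 0)%VS.
have UW : (U <= W)%VS.
  apply: contraT => UW; have := minV U (conj (Lstable_preim LV LZ) UW) (capvSl _ _).
  move=> UV; move: vV; rewrite -UV memv_cap -memv_preim -gE memv0 (negPf g0).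
  by rewrite andbF.
apply: (subvP UW); rewrite memv_cap -memv_preim memvB ?memvZ ?LV //= memv0.
by rewrite linearB linearZ /= -LRact -gE Lact_grouplike // subrr.
Qed.

End DualAction.

(** * The coradical filtration of a pointed coalgebra *)

Section Nilpotence.
Variables (K : fieldType) (C : coalgType K).
Local Notation dual := 'Hom(C, K^o).
Implicit Types (f g : dual) (x : C).

(** These functionals form a two-sided ideal of the dual algebra, written J below. *)
Definition vanish f := forall h : C, grouplike h -> f h = 0.

(** Products f = a_1 ... a_n c with all a_i in J; J being an ideal, these span J^n
for positive n, and the whole dual for n = 0. *)
Fixpoint Jpow n f : Prop :=
  if n is n'.+1 then exists a b, [/\ vanish a, Jpow n' b & f = dmul a b] else True.

(** The orthogonal of J^n, that is, for pointed C, the term of index n-1 of the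
coradical filtration; the index is shifted so that only 0 is killed at level 0. *)
Definition killed n x := forall f, Jpow n f -> f x = 0.

Lemma dmul_grouplike f g (h : C) : grouplike h -> dmul f g h = f h * g h :> K.
Proof.
by move=> hh; rewrite -dual_Lact Lact_grouplike // linearZ.
Qed.

Lemma killedW n x : killed n x -> killed n.+1 x.
Proof.
move=> kx _ [a [b [Ja Jb ->]]]; 
elim: n a b Ja Jb kx => [|n IH] a b Ja /= Jb kx; first exact: kx.
case: Jb => a' [b' [Ja' Jb' ->]].
apply: kx; exists (dmul a a'), b'; split => //; last exact: dmulA.
by move=> h hh; rewrite dmul_grouplike // Ja // mul0r.
Qed.

Lemma killed_Lact n a x : vanish a -> killed n.+1 x -> killed n (Lact a x).
Proof. by move=> Ja kx f Jf; rewrite dual_Lact; apply: kx; exists a, f. Qed.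

Hypothesis pointedC : pointed C.

(** Each time W is enlarged by a vector v on which the dual acts modulo W through a
group-like, J sends W + K v into W: one more factor in J is needed to kill it. *)
Lemma killed_dim_aux n : exists2 W, Lstable W &
  (minn n (\dim {:C}) <= \dim W)%N /\ forall x, x \in W -> killed n x.
Proof.
elim: n => [|n [W LW [dW kW]]].
  exists 0%VS; first by move=> f x; rewrite !memv0 => /eqP ->; rewrite linear0.
  by rewrite min0n; split=> // x; rewrite memv0 => /eqP -> f _; rewrite linear0.
have [Wf|Wf] := eqVneq W {:C}%VS.
  exists {:C}%VS; first by move=> f x _; apply: memvf.
  split; first by rewrite geq_minr.
  by move=> x _; apply: killedW; apply: kW; rewrite Wf memvf.
have [v [g [vW gg Lv]]] := coideal_quotient_eigen pointedC LW Wf.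
have Lv' f : exists2 w, w \in W & Lact f v = (f g : K) *: v + w.
  by exists (Lact f v - (f g : K) *: v); rewrite // addrC subrK.
have ME x : x \in (W + <[v]>)%VS -> exists w k, w \in W /\ x = w + k *: v.
  by case/memv_addP=> w wW [_ /vlineP[k ->] ->]; exists w, k.
exists (W + <[v]>)%VS.
  move=> f _ /ME[w [k [wW ->]]]; have [w' w'W E] := Lv' f.
  rewrite linearD linearZ /= E scalerDr addrC -addrA scalerA addrC.
  rewrite memv_add ?memvZ ?memv_line //.
  by rewrite memvD ?memvZ ?LW.
split.
  rewrite dimv_disjoint_sum ?dim_vline; last first.
    apply/eqP; rewrite -subv0; apply/subvP => x.
    rewrite memv_cap memv0 => /andP[xW /vlineP[k xE]].
    have [k0|k0] := eqVneq k 0; first by rewrite xE k0 scale0r.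
    by case/negP: vW; rewrite -[v]scale1r -(mulVf k0) -scalerA -xE memvZ.
  have -> : v != 0 by apply: contraNneq vW => ->; rewrite mem0v.
  move: dW; rewrite addn1; lia.
move=> _ /ME[w [k [wW ->]]] _ [a [b [Ja Jb ->]]].
have [w' w'W E] := Lv' a.
rewrite -dual_Lact; apply: (kW) => //.
by rewrite linearD linearZ /= E Ja // scale0r add0r memvD ?memvZ ?LW.
Qed.

(** Equivalently, J is nilpotent and the coradical filtration is exhaustive. *)
Lemma killed_dim x : killed (\dim {:C}) x.
Proof.
have [W _ [dW]] := killed_dim_aux (\dim {:C}); rewrite minnn in dW; apply.
suff -> : W = {:C}%VS by apply: memvf.
by apply/eqP; rewrite eqEdim subvf.
Qed.

Definition coalg_endo (psi : 'End(C)) :=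
  (forall x, comul (psi x) = tmap psi psi (comul x)) /\
  (forall x, counit (psi x) = counit x).

Lemma dmul_coalg_endo psi f g : coalg_endo psi ->
  (dmul f g \o psi = dmul (f \o psi) (g \o psi))%VF.
Proof.
case=> cp _; apply/lfunP => x; rewrite comp_lfunE !dmulE cp tlift_tmap.
  by apply: (@eq_tlift _ _ _ K^o) => a b; rewrite !comp_lfunE.
exact: (bilin_comp _ _ (mul_bilin K^o)).
Qed.

Lemma Jpow_dmull n f g : Jpow n f -> Jpow n (dmul g f).
Proof.
case: n => [|n] //= [a [b [Ja Jb ->]]]; exists (dmul g a), b; split=> //; last exact: dmulA.
by move=> h hh; rewrite dmul_grouplike // Ja // mulr0.
Qed.

Lemma Jpow_add m n f g : Jpow m f -> Jpow n g -> Jpow (m + n) (dmul f g).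
Proof.
elim: m f => [|m IH] f; first by move=> _ Jg; apply: Jpow_dmull.
case=> a [b [Ja Jb ->]] Jg; exists a, (dmul b g); split=> //; first exact: IH.
by rewrite dmulA.
Qed.

(** If psi is trivial on the first two layers of the filtration then psi - 1 lowers
the filtration. By duality this is the following fact: an endomorphism of an
algebra which is the identity modulo J, and modulo J^2 on J, is the identity
modulo J^(n+1) on each product of n factors in J. The proof changes the factors
of a product a b one at a time; each replacement is evaluated at a slice of x
lying lower in the filtration. *)
Lemma endo_sub_killed (psi : 'End(C)) n x : coalg_endo psi ->
  (forall x, killed 1 x -> psi x = x) ->
  (forall y f, killed 2 y -> vanish f -> f (psi y) = f y) ->
  killed n.+1 x -> killed n (psi x - x).
Proof.
move=> cp p0 p1 kx f Jf; rewrite linearB /=; apply/eqP; rewrite subr_eq0; apply/eqP.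
elim: n f Jf x kx => [|n IH] f; first by move=> _ x kx; rewrite p0.
case=> a [b [Ja Jb ->]] x kx.
have Jap : vanish (a \o psi)%VF.
  move=> h hh; rewrite comp_lfunE p0 ?Ja // => _ [a' [b' [Ja' _ ->]]].
  by rewrite dmul_grouplike // Ja' // mul0r.
rewrite -[LHS]comp_lfunE dmul_coalg_endo // -dual_Lact comp_lfunE.
rewrite IH //; last exact: killed_Lact.
rewrite dual_Lact -!dual_Ract [LHS]comp_lfunE p1 //.
move=> f' Jf'; rewrite dual_Ract; apply: kx.
exact: (Jpow_add (m := 2)).
Qed.

Lemma endo_unipotent (psi : 'End(C)) : coalg_endo psi ->
  (forall x, killed 1 x -> psi x = x) ->
  (forall y f, killed 2 y -> vanish f -> f (psi y) = f y) ->
  forall x, iter (\dim {:C}) (fun y => psi y - y) x = 0.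
Proof.
move=> cp p0 p1 x.
have E m n y : killed (m + n) y -> killed n (iter m (fun y => psi y - y) y).
  elim: m y => // m IH y; rewrite addSn => ky; rewrite iterSr; apply: IH.
  exact: endo_sub_killed.
apply: dual_eq0 => f; apply: (E _ 0%N) => //; rewrite addn0; exact: killed_dim.
Qed.

End Nilpotence.

(** * The group of group-like elements *)

Section Grouplikes.
Variables (K : fieldType) (C : coalgType K).

Lemma grouplike_enum : exists s : seq C,
  [/\ uniq s, s =i @grouplike K C & size s = grouplike_order C].
Proof.
have E : fset_set (@grouplike_set K C) =i @grouplike K C.
  move=> g; rewrite (in_fset_set (@finite_grouplike_set K C)).
  by apply/idP/idP; rewrite classical_sets.in_setE.
exists (fset_set (@grouplike_set K C)); split=> //; exact: fset_uniq.
Qed.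

(** Distinct group-likes are linearly independent. *)
Lemma grouplike_dual_basis : exists e : C -> 'Hom(C, K^o),
  forall g h, grouplike g -> grouplike h -> e g h = (g == h)%:R :> K.
Proof.
have [s [us sG _]] := grouplike_enum.
have fs : free s by apply: grouplike_free => //; apply/allP => g; rewrite sG.
exists (fun g => if insub (index g s) is Some i then coordf (in_tuple s) i else 0).
move=> g h gg hh; have gs : g \in s by rewrite sG.
have hs : h \in s by rewrite sG.
have gi : (index g s < size s)%N by rewrite index_mem.
rewrite insubT /= coordfE -{1}(nth_index 0 hs).
have hi : (index h s < size s)%N by rewrite index_mem.
rewrite -[index h s]/(val (Ordinal hi)) (coord_free (X := in_tuple s)) // -val_eqE /=.
congr (_%:R); congr nat_of_bool; apply/eqP/eqP => [E|-> //].
by rewrite -(nth_index 0 gs) -(nth_index 0 hs) E.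
Qed.

End Grouplikes.

Section HopfGrouplikes.
Variables (K : fieldType) (H : hopfAlgType K).
Local Notation S := (antipode : 'End(H)).

Lemma mull_lin (g : H) : linear (fun x => g * x).
Proof. by move=> k u v; rewrite mulrDr scalerAr. Qed.

Lemma grouplike1 : grouplike (1 : H).
Proof. by rewrite /grouplike oner_neq0 comul1 eqxx. Qed.

Lemma grouplike_neq0 (g : H) : counit g = 1 -> g != 0.
Proof. by move=> e1; apply/eqP => g0; move/eqP: e1; rewrite g0 linear0 eq_sym oner_eq0. Qed.

Lemma grouplikeM (g h : H) : grouplike g -> grouplike h -> grouplike (g * h).
Proof.
move=> gg hh; have [_ cg] := grouplikeP gg; have [_ ch] := grouplikeP hh.
rewrite /grouplike comulM cg ch tmulE eqxx andbT grouplike_neq0 //.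
by rewrite counitM !counit_grouplike ?mulr1.
Qed.

Lemma grouplikeS (g : H) : grouplike g -> grouplike (S g).
Proof.
move=> gg; have [_ cg] := grouplikeP gg.
rewrite /grouplike grouplike_neq0 ?counit_antipode ?counit_grouplike //=.
rewrite antipode_comul cg tlift_bilin //.
by split=> [v|u] k a b; rewrite linearP ?tens_linearl ?tens_linearr.
Qed.

Lemma mulSg (g : H) : grouplike g -> S g * g = 1.
Proof.
move=> gg; have [_ cg] := grouplikeP gg; have := antipodeSl g.
rewrite cg tlift_bilin ?counit_grouplike ?scale1r //.
by split=> [v|u] k a b; rewrite ?linearP ?mulrDl ?mulrDr -?scalerAl -?scalerAr.
Qed.

Lemma mulgS (g : H) : grouplike g -> g * S g = 1.
Proof.
move=> gg; have [_ cg] := grouplikeP gg; have := antipodeSr g.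
rewrite cg tlift_bilin ?counit_grouplike ?scale1r //.
by split=> [v|u] k a b; rewrite ?linearP ?mulrDl ?mulrDr -?scalerAl -?scalerAr.
Qed.

Lemma antipodeK_grouplike (g : H) : grouplike g -> S (S g) = g.
Proof.
move=> gg; rewrite -[LHS]mulr1 -(mulSg gg) mulrA mulSg ?mul1r //; exact: grouplikeS.
Qed.

(** Lagrange, for the finite group carried by the enumeration of G(H). *)
Lemma grouplike_expN (c : H) : grouplike c -> c ^+ grouplike_order H = 1.
Proof.
move=> gc; have [s [us sG <-]] := grouplike_enum H.
have sM (x y : seq_sub s) : val x * val y \in s.
  by rewrite sG; apply: grouplikeM; rewrite -[grouplike _]sG; apply: valP.
have s1 : 1 \in s by rewrite sG; apply: grouplike1.
have sS (x : seq_sub s) : S (val x) \in s.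
  by rewrite sG; apply: grouplikeS; rewrite -[grouplike _]sG; apply: valP.
pose m (x y : seq_sub s) := SeqSub (sM x y).
pose o := SeqSub s1.
pose i x := SeqSub (sS x).
have mA : associative m by move=> x y z; apply: val_inj; rewrite /= mulrA.
have m1 : left_id o m by move=> x; apply: val_inj; rewrite /= mul1r.
have mV : left_inverse o i m.
  by move=> x; apply: val_inj; rewrite /= mulSg //; rewrite -[grouplike _]sG; apply: valP.
pose gT : finGroupType := HB.pack (seq_sub s) (Finite_isGroup.Build (seq_sub s) mA m1 mV).
have cs : c \in s by rewrite sG.
pose x : gT := SeqSub cs.
have xE n : val (x ^+ n : seq_sub s)%g = c ^+ n.
  by elim: n => // n IH; rewrite expgS exprS -IH.
have := expg_cardG (in_setT x); rewrite cardsT.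
have -> : #|gT| = size s by rewrite -(card_seq_sub us).
by move/(congr1 val); rewrite xE.
Qed.

Lemma Lact_mull f (g x : H) : grouplike g ->
  Lact f (g * x) = g * Lact (f \o linfun (fun x => g * x))%VF x.
Proof.
move=> gg; have [_ cg] := grouplikeP gg.
rewrite !LactE comulM cg (tlift_lin _ _ (mull_lin g)).
have [_ mr] := tmul_bilin H H.
rewrite -[X in tmul _ X]tliftK (tlift_lin _ _ (mr _)) (tlift_lin _ _ (lfun_linear _)).
apply: eq_tlift => a b; rewrite tmulE slicel_tens.
by rewrite -scalerAr comp_lfunE -(linfunE (mull_lin g)).
Qed.

(** The coideal W is enlarged, together with its stability under left multiplication
by G(H), by the translates k v of an eigenvector v modulo W. The dual acts on
k v, modulo W, through the group-like k g; these group-likes are distinct, so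
the N translates are independent modulo W and the dimension grows by N. *)
Lemma grouplike_order_dvd_dim : pointed H -> (grouplike_order H %| \dim {:H})%N.
Proof.
move=> pH; have [s [us sG <-]] := grouplike_enum H.
have [e eE] := grouplike_dual_basis H.
suff dvdC n (W : {vspace H}) : (\dim {:H} - \dim W <= n)%N -> Lstable W ->
    (forall g x, grouplike g -> x \in W -> g * x \in W) ->
    (size s %| \dim {:H} - \dim W)%N.
  have := dvdC _ 0%VS (leqnn _); rewrite dimv0 subn0; apply=> [f x|g x _].
    by rewrite !memv0 => /eqP ->; rewrite linear0.
  by rewrite !memv0 => /eqP ->; rewrite mulr0.
elim: n W => [|n IH] W; first by rewrite leqn0 => /eqP ->.
move=> dW LW gW; have [->|Wf] := eqVneq W {:H}%VS; first by rewrite subnn.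
have [v [g [vW gg Lv]]] := coideal_quotient_eigen pH LW Wf.
have Lkv f k : grouplike k -> Lact f (k * v) - (f (k * g) : K) *: (k * v) \in W.
  move=> gk; rewrite Lact_mull // scalerAr -mulrBr gW //.
  have -> : (f (k * g) : K) = (f \o linfun (fun x => k * x))%VF g.
    by rewrite comp_lfunE -(linfunE (mull_lin k)).
  exact: Lv.
pose X : (size s).-tuple H := [tuple of [seq k * v | k <- in_tuple s]].
have sK (i : 'I_(size s)) : grouplike s`_i by rewrite -[grouplike _]sG mem_nth.
(* The functional dual to s_i g extracts the i-th term of a relation modulo W. *)
have indep (c : 'I_(size s) -> K) : \sum_i c i *: (s`_i * v) \in W -> forall i, c i = 0.
  move=> cW i; have := LW (e (s`_i * g)) _ cW; rewrite linear_sum.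
  under eq_bigr => j _ do rewrite linearZ /=.
  move=> A.
  have B : \sum_j c j *: (Lact (e (s`_i * g)) (s`_j * v)
            - (e (s`_i * g) (s`_j * g) : K) *: (s`_j * v)) \in W.
    by rewrite memv_suml // => j _; rewrite memvZ // Lkv.
  have := memvB A B; rewrite -sumrB.
  under eq_bigr => j _ do rewrite -scalerBr opprB addrC subrK.
  rewrite (bigD1 i) //= eE ?grouplikeM // eqxx scale1r big1 ?addr0 => [cv|j ji].
    apply/eqP; apply: contraNT vW => c0.
    rewrite -[v]mul1r -(mulSg (sK i)) -mulrA gW ?grouplikeS //.
    by rewrite -[_ * v]scale1r -(mulVf c0) -scalerA memvZ.
  rewrite eE ?grouplikeM // (_ : _ == _ = false) ?scale0r ?scaler0 //.
  apply: contraNF ji => /eqP E.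
  rewrite -val_eqE /= -(nth_uniq 0 (ltn_ord j) (ltn_ord i) us).
  by rewrite -[s`_i]mulr1 -[s`_j]mulr1 -(mulgS gg) !mulrA E.
have XE (i : 'I_(size s)) : X`_i = s`_i * v by rewrite (nth_map 0).
have fX : free X.
  apply/freeP => c c0; apply: indep; under eq_bigr => i _ do rewrite -XE.
  by rewrite c0 mem0v.
have dW' : \dim (W + <<X>>) = (\dim W + size s)%N.
  rewrite dimv_disjoint_sum ?(eqnP fX) ?size_tuple //.
  apply/eqP; rewrite -subv0; apply/subvP => x.
  rewrite memv_cap memv0 => /andP[xW /coord_span xX].
  move: xW; rewrite {1}xX; under eq_bigr => i _ do rewrite XE.
  move/indep => c0; rewrite xX big1 // => i _; by rewrite c0 scale0r.
have s0 : (0 < size s)%N.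
  have : (1 : H) \in s by rewrite sG; apply: grouplike1.
  by case: (s).
have le' : (\dim W + size s <= \dim {:H})%N by rewrite -dW' dimvS ?subvf.
(* Membership in W + span X is used through this induction principle *)
have XW' (P : H -> Prop) : (forall k, grouplike k -> P (k * v)) ->
    (forall x y, P x -> P y -> P (x + y)) -> (forall k x, P x -> P (k *: x)) ->
    P 0 -> (forall x, x \in W -> P x) -> forall x, x \in (W + <<X>>)%VS -> P x.
  move=> P1 PD PZ P0 PW x /memv_addP[w wW [u /coord_span -> ->]].
  apply: (PD); first exact: PW.
  by apply: (big_ind P P0 PD) => i _; rewrite XE; apply: PZ; apply: P1; apply: sK.
have kX k : grouplike k -> k * v \in (W + <<X>>)%VS.
  move=> gk; apply: (subvP (addvSr _ _)); apply: memv_span; apply/mapP; exists k => //.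
  by rewrite -[in_tuple s : seq _]/s sG.
have WX x : x \in W -> x \in (W + <<X>>)%VS by apply/subvP/addvSl.
have : (size s %| \dim {:H} - \dim (W + <<X>>))%N.
  apply: IH; first by rewrite dW'; lia.
    move=> f; apply: XW' => [k gk|x y|k x||x xW].
    - rewrite -(subrK ((f (k * g) : K) *: (k * v)) (Lact f _)).
      by apply: memvD; [exact/WX/Lkv | rewrite memvZ ?kX].
    - by rewrite linearD /=; apply: memvD.
    - by rewrite linearZ /=; apply: memvZ.
    - by rewrite linear0 mem0v.
    - by rewrite WX ?LW.
  move=> k x gk; move: x; apply: XW' => [h gh|x y|a x||x xW].
  - by rewrite mulrA kX // grouplikeM.
  - by rewrite mulrDr; apply: memvD.
  - by rewrite -scalerAr; apply: memvZ.
  - by rewrite mulr0 mem0v.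
  - by rewrite WX ?gW.
rewrite dW' => dv.
have -> : (\dim {:H} - \dim W = (\dim {:H} - (\dim W + size s)) + size s)%N.
  by lia.
by rewrite dvdn_add.
Qed.

End HopfGrouplikes.

(** * The first two terms of the coradical filtration *)

Section GroupSpan.
Variables (K : fieldType) (C : coalgType K).

(** This is the coradical when C is pointed. *)
Definition group_span : {vspace C} := <<fset_set (@grouplike_set K C)>>%VS.

Lemma grouplike_span (g : C) : grouplike g -> g \in group_span.
Proof.
move=> gg; apply: memv_span; rewrite (in_fset_set (@finite_grouplike_set K C)).
by rewrite classical_sets.in_setE.
Qed.

Lemma group_span_img (V : vectType K) (h : C -> V) (W : {vspace V}) : linear h ->
  (forall g, grouplike g -> h g \in W) -> forall x, x \in group_span -> h x \in W.
Proof.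
move=> hl hW x /(memv_img (linfun h)); rewrite -(linfunE hl); apply/subvP.
rewrite limg_span; apply/span_subvP => _ /mapP[g + ->]; rewrite -(linfunE hl).
rewrite (in_fset_set (@finite_grouplike_set K C)) classical_sets.in_setE; exact: hW.
Qed.

Lemma vanish_span (f : 'Hom(C, K^o)) x : vanish f -> x \in group_span -> f x = 0.
Proof.
move=> Jf xs; apply/eqP; rewrite -memv0; apply: group_span_img (lfun_linear f) _ x xs.
by move=> g gg; rewrite Jf // mem0v.
Qed.

(** The span of the group-likes is its own double orthogonal. *)
Lemma group_span_separated (x : C) :
  (forall f : 'Hom(C, K^o), vanish f -> f x = 0) -> x \in group_span.
Proof.
move=> kx; apply: contraT => /dual_sep [f [fs f1]].
have : f x = 0 by apply: kx => g gg; apply/fs/grouplike_span.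
by rewrite f1 => /eqP; rewrite oner_eq0.
Qed.

Lemma killed1 (x : C) : killed 1 x -> x \in group_span.
Proof.
move=> kx; apply: group_span_separated => f Jf; apply: kx; exists f, counit; split=> //.
by rewrite dmul1r.
Qed.

Lemma killed2 (x : C) (a b : 'Hom(C, K^o)) :
  killed 2 x -> vanish a -> vanish b -> forall c, dmul a (dmul b c) x = 0.
Proof.
move=> kx Ja Jb c; apply: kx; exists a, (dmul b c); split=> //.
by exists b, c.
Qed.

(** A functional a (f b) with a and f in J is a product of two elements of J, hence
vanishes at x; varying f, this places the slice in the span of the group-likes. *)
Lemma killed2_Lact (x : C) (a b : 'Hom(C, K^o)) : killed 2 x -> vanish a ->
  Lact a (Ract b x) \in group_span.
Proof.
move=> kx Ja; apply: group_span_separated => f Jf.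
by rewrite dual_Lact dual_Ract -dmulA killed2.
Qed.

Lemma vanish_ideall (a b : 'Hom(C, K^o)) : vanish a -> vanish (dmul b a).
Proof. by move=> Ja h hh; rewrite dmul_grouplike // Ja // mulr0. Qed.

Lemma killed2_Ract (x : C) (a b : 'Hom(C, K^o)) : killed 2 x -> vanish a ->
  Ract a (Lact b x) \in group_span.
Proof.
move=> kx Ja; apply: group_span_separated => f Jf.
rewrite dual_Ract dual_Lact dmulA -[dmul _ _](dmul1r) -dmulA killed2 //.
exact: vanish_ideall.
Qed.

(** Modulo the span C_0 of the group-likes, the elements killed at level 2 form a
bicomodule over C_0, graded on both sides by the group-likes. The component of degree (g, h) of x
is cut out by the functionals e_g and e_h of a dual basis of G(H): their sum is
the unit eps modulo J, and e_g f = f(g) e_g modulo J. *)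
Lemma killed2_decomp (x : C) : killed 2 x ->
  exists (I : finType) (y : I -> C) (g h : I -> C),
  x - \sum_i y i \in group_span /\
  forall i, [/\ grouplike (g i), grouplike (h i) &
    comul (y i) - g i *t y i - y i *t h i \in tensv group_span group_span].
Proof.
move=> kx; have [s [us sG _]] := grouplike_enum C.
have [e eE] := grouplike_dual_basis C.
pose n := size s; have sK (i : 'I_n) : grouplike s`_i by rewrite -[grouplike _]sG mem_nth.
pose y (p : 'I_n * 'I_n) := Lact (e s`_p.1) (Ract (e s`_p.2) x).
exists ('I_n * 'I_n)%type, y, (fun p : 'I_n * 'I_n => s`_p.1),
  (fun p : 'I_n * 'I_n => s`_p.2); split.
  pose E := \sum_(i < n) e s`_i.
  have JE : vanish (counit - E).
    move=> g gg; rewrite add_lfunE opp_lfunE counit_grouplike // sum_lfunE.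
    have gs : (index g s < n)%N by rewrite index_mem sG.
    have gi : s`_(Ordinal gs) = g by rewrite /= nth_index // sG.
    rewrite (bigD1 (Ordinal gs)) //= eE ?sK // nth_index ?sG // eqxx.
    rewrite big1 ?addr0 ?subrr // => i ig.
    rewrite eE ?sK // -[in X in _ == X]gi nth_uniq ?ltn_ord // val_eqE.
    by rewrite (negPf ig).
  have -> : \sum_p y p = Lact E (Ract E x).
    rewrite -(pair_bigA _ (fun i j : 'I_n => Lact (e s`_i) (Ract (e s`_j) x))) /=.
    rewrite (linear_bigsum (@Lact_lin _ _ _)); apply: eq_bigr => i _.
    by rewrite (linear_bigsum (@Ract_lin _ _ x)) linear_sum.
  (* both terms on the right are slices by elements of J *)
  have -> : x - Lact E (Ract E x) =
      Lact (counit - E) (Ract counit x) + Ract (counit - E) (Lact E x).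
    by rewrite LactB RactB !Ract1 Lact1 -LRact addrA subrK.
  by rewrite memvD ?killed2_Lact ?killed2_Ract.
move=> [i j] /=; split; rewrite ?sK //.
apply: tensv_slices => f; rewrite !linearB /=.
  rewrite !slicel_tens -LactE memvB //; last by rewrite memvZ // grouplike_span.
  rewrite /y /= Lact_comp -(linear_scale (@Lact_lin _ _ _)) -LactB killed2_Lact // => k kk.
  rewrite add_lfunE opp_lfunE scale_lfunE dmul_grouplike // eE //.
  by case: eqP => [<-|]; rewrite ?mul1r ?mul0r ?scaler0 ?subrr // [_ *: _]mulr1 subrr.
rewrite !slicer_tens addrAC -RactE memvB //; last by rewrite memvZ // grouplike_span.
rewrite /y /= LRact Ract_comp -(linear_scale (@Ract_lin _ _ _)) -RactB.
rewrite killed2_Ract // => k kk.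
rewrite add_lfunE opp_lfunE scale_lfunE dmul_grouplike // eE //.
by case: eqP => [<-|]; rewrite ?mulr1 ?mulr0 ?scaler0 ?subrr // [_ *: _]mulr1 subrr.
Qed.

End GroupSpan.

(** * The square of the antipode *)

Section SquareAntipode.
Variables (K : fieldType) (H : hopfAlgType K).
Local Notation S := (antipode : 'End(H)).
Local Notation H0 := (@group_span K H).

Lemma group_spanM (x y : H) : x \in H0 -> y \in H0 -> x * y \in H0.
Proof.
move=> xs ys; have [ml mr] := mul_bilin H.
apply: (group_span_img (h := fun x => x * y)) x xs => [|g gg]; first exact: ml.
apply: (group_span_img (h := fun y => g * y)) y ys => [|h hh]; first exact: mr.
exact/grouplike_span/grouplikeM.
Qed.

Lemma group_spanS (x : H) : x \in H0 -> S x \in H0.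
Proof.
by apply: group_span_img => [|g gg]; [exact: lfun_linear | exact/grouplike_span/grouplikeS].
Qed.

Definition sqantipode : 'End(H) := (S \o S)%VF.

Lemma sqantipodeE x : sqantipode x = S (S x).
Proof. exact: comp_lfunE. Qed.

Lemma sqantipodeM x y : sqantipode (x * y) = sqantipode x * sqantipode y.
Proof. by rewrite !sqantipodeE !antipodeM. Qed.

Lemma sqantipode_grouplike g : grouplike g -> sqantipode g = g.
Proof. by move=> gg; rewrite sqantipodeE antipodeK_grouplike. Qed.

Lemma sqantipode_coalg_endo : coalg_endo sqantipode.
Proof.
split=> x; last by rewrite sqantipodeE !counit_antipode.
rewrite sqantipodeE !antipode_comul (tlift_lin _ _ (lfun_linear _)) tmap_tlift.
apply: eq_tlift => a b; rewrite tlift_bilin ?sqantipodeE //.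
by split=> [v|u] k y z; rewrite linearP ?tens_linearl ?tens_linearr.
Qed.

(** Applying S(y1) y2 = eps(y) 1 to the given form of Delta(y) shows that
S(y) = - g^-1 y h^-1 modulo the span of the group-likes. Then S is applied to this
congruence, and S(y) is replaced by the same congruence in the outcome. *)
Lemma sqantipode_skew (y g h : H) : grouplike g -> grouplike h ->
  comul y - g *t y - y *t h \in tensv H0 H0 ->
  sqantipode y - (h * S g) * y * (S h * g) \in H0.
Proof.
move=> gg hh yw; have [ml mr] := mul_bilin H.
have bS : bilin (fun a b : H => S a * b).
  by split=> [v|u] k a b; rewrite ?linearP ?mulrDl ?mulrDr -?scalerAl -?scalerAr.
have z0 : S g * y + S y * h \in H0.
  have : tlift (fun a b : H => S a * b) (comul y - g *t y - y *t h) \in H0.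
    apply: tensv_img yw => u v us vs; rewrite tlift_bilin //.
    by rewrite group_spanM // group_spanS.
  rewrite !linearB /= !tlift_bilin // antipodeSl -addrA -opprD => z0.
  rewrite -(subKr (counit y : K)%:A (S g * y + S y * h)) memvB // memvZ //.
  exact/grouplike_span/grouplike1.
have z1 : S y + S g * y * S h \in H0.
  have -> : S y + S g * y * S h = (S g * y + S y * h) * S h.
    by rewrite mulrDl -[S y * h * _]mulrA mulgS // mulr1 addrC.
  by rewrite group_spanM // grouplike_span // grouplikeS.
have := memvB (group_spanS z1)
  (group_spanM (group_spanM (grouplike_span hh) z1) (grouplike_span gg)).
congr (_ \in H0); rewrite linearD /= !antipodeM.
rewrite (antipodeK_grouplike gg) (antipodeK_grouplike hh) sqantipodeE.
by rewrite mulrDr mulrDl !mulrA addrKA.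
Qed.

(** Here c and d are fixed by the square of the antipode, which is multiplicative. *)
Lemma iter_sqantipode_skew n (c d y : H) : grouplike c -> grouplike d ->
  sqantipode y - c * y * d \in H0 -> iter n sqantipode y - c ^+ n * y * d ^+ n \in H0.
Proof.
move=> gc gd yw; have gX k (x : H) : grouplike x -> grouplike (x ^+ k).
  by move=> gx; elim: k => [|k IH]; [exact: grouplike1 | by rewrite exprS grouplikeM].
elim: n => [|n IH]; first by rewrite !expr0 mul1r mulr1 subrr mem0v.
have sqS0 x : x \in H0 -> sqantipode x \in H0 by move=> ?; rewrite sqantipodeE !group_spanS.
have cyd := group_spanM (group_spanM (grouplike_span (gX n _ gc)) yw)
  (grouplike_span (gX n _ gd)).
have := memvD (sqS0 _ IH) cyd.
rewrite linearB /= !sqantipodeM !(sqantipode_grouplike (gX n _ _)) //.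
rewrite mulrBr mulrBl addrA subrK.
by rewrite exprSr exprS !mulrA.
Qed.

(** On each component of the decomposition of x the N-th power acts by
y -> c^N y d^N modulo the span of the group-likes, and c^N = d^N = 1. *)
Lemma vanish_iter_sqantipode (x : H) (f : 'Hom(H, K^o)) : killed 2 x -> vanish f ->
  f (iter (grouplike_order H) sqantipode x) = f x.
Proof.
set N := grouplike_order H => kx Jf.
have il : linear (iter N sqantipode).
  by elim: N => // n IH k u v; rewrite !iterS IH linearP.
have iB u v : iter N sqantipode (u - v) = iter N sqantipode u - iter N sqantipode v.
  by rewrite !(linfunE il) linearB.
have i0 u : u \in H0 -> iter N sqantipode u \in H0.
  by move=> us; elim: (N) => // n IH; rewrite iterS sqantipodeE !group_spanS.
have [I [y [g [h [xy ygh]]]]] := killed2_decomp kx.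
suff iy : iter N sqantipode (\sum_i y i) - \sum_i y i \in H0.
  have : iter N sqantipode x - x \in H0.
    have := memvD (memvB (i0 _ xy) xy) iy; rewrite iB.
    by congr (_ \in H0); rewrite addrAC [X in X - _]addrA subrK opprB addrA subrK.
  by move/(vanish_span Jf); rewrite linearB => /eqP; rewrite subr_eq0 => /eqP.
rewrite (linear_bigsum il) -sumrB memv_suml // => i _.
have [gi hi ys] := ygh i.
have := iter_sqantipode_skew N _ _ (sqantipode_skew gi hi ys).
by rewrite !grouplike_expN ?mul1r ?mulr1 ?grouplikeM ?grouplikeS //; apply.
Qed.

Lemma iter_sqantipode_unipotent (psi : 'End(H)) : pointed H ->
  (forall x, psi x = iter (grouplike_order H) sqantipode x) ->
  forall x, iter (\dim {:H}) (fun y => psi y - y) x = 0.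
Proof.
move=> pH psiE; apply: endo_unipotent => //.
- have [cS eS] := sqantipode_coalg_endo; split=> x; rewrite psiE; last first.
    by elim: (grouplike_order H) => // n IH; rewrite iterS eS IH.
  have -> : tmap psi psi (comul x) =
      tlift (fun a b => iter (grouplike_order H) sqantipode a *t
                        iter (grouplike_order H) sqantipode b) (comul x).
    by apply: eq_tlift => a b; rewrite !psiE.
  elim: (grouplike_order H) => [|n IH]; first by rewrite /= tliftK.
  rewrite iterS cS IH (tlift_lin _ _ (lfun_linear _)).
  by apply: eq_tlift => a b; rewrite tmapE.
- move=> x /killed1 xs; apply/eqP; rewrite -subr_eq0 -memv0.
  have il : linear (fun x => psi x - x).
    by move=> k u v; rewrite linearP opprD scalerBr addrACA.
  apply: (group_span_img il) x xs => g gg; rewrite psiE.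
  suff -> : iter (grouplike_order H) sqantipode g = g by rewrite subrr mem0v.
  by elim: (grouplike_order H) => // n IH; rewrite iterS IH sqantipode_grouplike.
- by move=> y f ky Jf; rewrite psiE; apply: vanish_iter_sqantipode.
Qed.

End SquareAntipode.

(** * Polynomial maps and powers of a unipotent element *)

Section PolynomialMaps.
Variables (K : fieldType).
Hypothesis charK0 : [pchar K] =i pred0.
Implicit Types U V W : vectType K.

(** Maps which are polynomial in one scalar, with coefficients in a vector space; an
arbitrary finite index type makes the stability under bilinear maps immediate. *)
Definition polymap W (f : K -> W) := exists (I : finType) (p : I -> {poly K}) (w : I -> W),
  forall t, f t = \sum_i (p i).[t] *: w i.

Lemma natr_inj0 : injective (fun n : nat => n%:R : K).
Proof.
move=> m n /eqP; wlog le_mn : m n / (m <= n)%N.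
  by move=> W; case: (leqP m n) => [/W //|/ltnW /W]; rewrite eq_sym => E /E ->.
rewrite eq_sym -subr_eq0 -natrB // ((pcharf0P K).1 charK0) subn_eq0 => le_nm.
by apply/eqP; rewrite eqn_leq le_mn.
Qed.

Lemma poly_nat_eq0 (p : {poly K}) : (forall n : nat, p.[n%:R] = 0) -> p = 0.
Proof.
move=> pn; apply: (@roots_geq_poly_eq0 _ p [seq n%:R | n <- iota 0 (size p)]).
- by apply/allP => _ /mapP[n _ ->]; apply/eqP.
- by rewrite map_inj_uniq ?iota_uniq //; apply: natr_inj0.
- by rewrite size_map size_iota.
Qed.

(** In characteristic zero the natural numbers form an infinite set of scalars, and
a polynomial that vanishes on it is zero. *)
Lemma polymap_eq0 W (f : K -> W) : polymap f -> (forall n : nat, f n%:R = 0) ->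
  forall t, f t = 0.
Proof.
case=> I [p [w fE]] fn t; apply: dual_eq0 => l.
pose q := \sum_i (l (w i) : K) *: p i.
have qE s : l (f s) = q.[s].
  rewrite fE linear_sum /q horner_sum; apply: eq_bigr => i _.
  by rewrite linearZ hornerZ; exact: (@mulrC K).
suff q0 : q = 0 by rewrite qE q0 horner0.
by apply: poly_nat_eq0 => n; rewrite -qE fn linear0.
Qed.

Lemma polymap_cst W (w : W) : polymap (fun=> w).
Proof.
exists unit, (fun=> 1), (fun=> w) => t.
by rewrite big_const card_unit /= addr0 hornerC scale1r.
Qed.

Lemma polymap_lin V W (h : V -> W) (f : K -> V) :
  linear h -> polymap f -> polymap (fun t => h (f t)).
Proof.
move=> hl [I [p [w fE]]]; exists I, p, (fun i => h (w i)) => t.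
by rewrite fE (linear_bigsum hl); apply: eq_bigr => i _; rewrite (linear_scale hl).
Qed.

Lemma polymap_bilin U V W (F : U -> V -> W) (f : K -> U) (g : K -> V) : bilin F ->
  polymap f -> polymap g -> polymap (fun t => F (f t) (g t)).
Proof.
case=> Fl Fr [I [p [u fE]]] [J [q [v gE]]].
exists (I * J)%type, (fun ij => p ij.1 * q ij.2), (fun ij => F (u ij.1) (v ij.2)) => t.
rewrite fE (linear_bigsum (Fl _)).
rewrite -(pair_bigA _ (fun i j => (p i * q j).[t] *: F (u i) (v j))) /=.
apply: eq_bigr => i _; rewrite (linear_scale (Fl _)) gE (linear_bigsum (Fr _)) scaler_sumr.
by apply: eq_bigr => j _; rewrite (linear_scale (Fr _)) scalerA hornerM.
Qed.

Lemma polymap_sub W (f g : K -> W) : polymap f -> polymap g -> polymap (fun t => f t - g t).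
Proof.
case=> [I [p [u fE]]] [J [q [v gE]]].
exists (I + J)%type, (fun k => match k with inl i => p i | inr j => q j end),
  (fun k => match k with inl i => u i | inr j => - v j end) => t.
rewrite big_sumType /= fE gE -sumrN; congr (_ + _).
by apply: eq_bigr => j _; rewrite scalerN.
Qed.

Lemma polymap_affine W (f : K -> W) a b : polymap f -> polymap (fun t => f (a * t + b)).
Proof.
case=> I [p [w fE]]; exists I, (fun i => p i \Po (a *: 'X + b%:P)), w => t.
by rewrite fE; apply: eq_bigr => i _; rewrite horner_comp !hornerE.
Qed.

Lemma polymap_eq W (f g : K -> W) : polymap f -> polymap g ->
  (forall n : nat, f n%:R = g n%:R) -> forall t, f t = g t.
Proof.
move=> pf pg fg t; apply/eqP; rewrite -subr_eq0; apply/eqP.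
by apply: polymap_eq0 (polymap_sub pf pg) _ t => n; rewrite fg subrr.
Qed.

(** The binomial coefficient t (t - 1) ... (t - k + 1) / k! as a polynomial in t. *)
Definition binomial_poly k : {poly K} := (k`!%:R)^-1 *: \prod_(i < k) ('X - i%:R%:P).

Lemma horner_binomial_poly k n : (binomial_poly k).[n%:R] = 'C(n, k)%:R.
Proof.
have kf : (k`!%:R : K) != 0 by rewrite ((pcharf0P K).1 charK0) -lt0n fact_gt0.
rewrite hornerZ horner_prod; apply: (mulfI kf); rewrite mulVKf // -natrM mulnC bin_ffact.
elim: k {kf} => [|k IH]; first by rewrite big_ord0.
rewrite big_ord_recr /= IH ffactnSr natrM !hornerE.
case: (leqP k n) => [le|lt]; first by rewrite natrB.
by rewrite ffact_small ?mul0r.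
Qed.

Variables (E : falgType K) (D : E) (M : nat).
Hypothesis DM : D ^+ M = 0.

(** The power (1 + D)^t, truncated where the powers of the nilpotent D vanish. *)
Definition unipow (t : K) : E := \sum_(k < M) (binomial_poly k).[t] *: D ^+ k.

Lemma polymap_unipow : polymap unipow.
Proof. by exists 'I_M, (fun k : 'I_M => binomial_poly k), (fun k : 'I_M => D ^+ k). Qed.

(** This is the binomial formula: the terms with k > n vanish because the binomial
coefficient does, the terms with k >= M because D^k does. *)
Lemma unipow_nat n : unipow n%:R = (1 + D) ^+ n.
Proof.
rewrite exprDn_comm; last exact/commr_sym/commr1.
pose F k := (D ^+ k) *+ 'C(n, k).
transitivity (\sum_(k < M) F k).
  by apply: eq_bigr => k _; rewrite horner_binomial_poly scaler_nat.
transitivity (\sum_(k < n.+1) F k); last first.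
  by apply: eq_bigr => k _; rewrite expr1n mul1r.
rewrite (big_ord_widen (M + n.+1)) ?leq_addr //.
rewrite [RHS](big_ord_widen (M + n.+1)) ?leq_addl //.
rewrite big_mkcond [RHS]big_mkcond; apply: eq_bigr => k _ /=.
case: ltnP => kM; case: ltnP => kn //; first by rewrite /F bin_small.
by rewrite /F -(subnK kM) exprD DM mulr0 mul0rn.
Qed.

End PolynomialMaps.

(** * The square root of the square of the antipode *)

Section AlmostInvolutive.
(* In the ring 'End(H), the product f * g is the composite g \o f. *)
Import FalgLfun.
Variables (K : fieldType) (H : hopfAlgType K).
Hypothesis charK0 : [pchar K] =i pred0.
Local Notation S := (antipode : 'End(H)).

Lemma hopf_morphismP (f : 'End(H)) : hopf_morphism f <->
  [/\ forall x y, f (x * y) = f x * f y, f 1 = 1,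
      forall x, comul (f x) = tmap f f (comul x),
      forall x, counit (f x) = counit x & forall x, f (S x) = S (f x)].
Proof.
split=> [[/ahom_inP[fM f1] fc fe fS]|[fM f1 fc fe fS]]; split=> //.
  by move=> x y; apply: fM; rewrite memvf.
by apply/ahom_inP; split=> // x y _ _.
Qed.

Lemma hopf_morphism1 : hopf_morphism (1 : 'End(H)).
Proof.
apply/hopf_morphismP; split=> *; rewrite ?id_lfunE //.
by rewrite tmap_tlift -[LHS]tliftK; apply: eq_tlift => a b; rewrite !id_lfunE.
Qed.

Lemma hopf_morphismM (f g : 'End(H)) :
  hopf_morphism f -> hopf_morphism g -> hopf_morphism (f * g).
Proof.
move=> /hopf_morphismP[fM f1 fc fe fS] /hopf_morphismP[gM g1 gc ge gS].
apply/hopf_morphismP.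
split=> *; rewrite ?lfun_mulE ?fM ?gM ?f1 ?g1 ?ge ?fe ?fS ?gS //.
rewrite gc fc tlift_tmap; last exact: (bilin_comp _ _ (tens_bilin _ _)).
by rewrite tmap_tlift; apply: eq_tlift => a b; rewrite !lfun_mulE.
Qed.

Lemma hopf_morphismX (f : 'End(H)) n : hopf_morphism f -> hopf_morphism (f ^+ n).
Proof.
move=> hf; elim: n => [|n IH]; first exact: hopf_morphism1.
by rewrite exprS; apply: hopf_morphismM.
Qed.

Lemma hopf_morphism_sqantipode : hopf_morphism (sqantipode H).
Proof.
have [cS eS] := sqantipode_coalg_endo H; apply/hopf_morphismP; split=> //.
- exact: sqantipodeM.
- by rewrite sqantipodeE !antipode1.
- by move=> x; rewrite !sqantipodeE.
Qed.

Lemma lfun_expE (f : 'End(H)) n x : (f ^+ n) x = iter n f x.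
Proof.
elim: n x => [|n IH] x; first by rewrite id_lfunE.
by rewrite exprS lfun_mulE IH iterSr.
Qed.

Lemma polymap_lfun (V W : vectType K) (f : K -> 'Hom(V, W)) x :
  polymap f -> polymap (fun t => f t x).
Proof.
apply: (polymap_lin (h := fun f : 'Hom(V, W) => f x)) => k f' g.
by rewrite add_lfunE scale_lfunE.
Qed.

(** With this, the compatibility of a family of maps with comultiplication is a
polynomial identity, in which the family occurs quadratically. *)
Lemma tmap_bilin t : bilin (fun f g : 'End(H) => tmap f g t).
Proof.
split=> [g|f] k x y; rewrite !tmap_tlift.
  rewrite -(tlift_param (F := fun (f : 'End(H)) a b => f a *t g b)) // => u v k' f f'.
  by rewrite add_lfunE scale_lfunE tens_linearl.
rewrite -(tlift_param (F := fun (g : 'End(H)) a b => f a *t g b)) // => u v k' g g'.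
by rewrite add_lfunE scale_lfunE tens_linearr.
Qed.

(** Both sides of every identity to be checked are polynomial in t, and natural powers
of the Hopf endomorphism 1 + D satisfy these identities. *)
Lemma hopf_morphism_unipow (D : 'End(H)) M t : D ^+ M = 0 -> hopf_morphism (1 + D) ->
  hopf_morphism (unipow D M t).
Proof.
move=> DM hU; have pu := polymap_unipow D M; have uE := unipow_nat charK0 DM.
have hn n : hopf_morphism (unipow D M n%:R) by rewrite uE; apply: hopf_morphismX.
have pux x := polymap_lfun x pu.
apply/hopf_morphismP; split.
- move=> x y; move: t; apply: (polymap_eq charK0) => // [|n].
    exact: (polymap_bilin (mul_bilin H)).
  by have /hopf_morphismP[] := hn n.
- move: t; apply: (polymap_eq charK0) => // [|n]; first exact: polymap_cst.
  by have /hopf_morphismP[] := hn n.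
- move=> x; move: t; apply: (polymap_eq charK0) => // [||n].
  + exact: (polymap_lin (lfun_linear _)).
  + exact: (polymap_bilin (tmap_bilin _)).
  by have /hopf_morphismP[] := hn n.
- move=> x; move: t; apply: (polymap_eq charK0) => // [||n].
  + exact: (polymap_lin (lfun_linear _)).
  + exact: polymap_cst.
  by have /hopf_morphismP[] := hn n.
- move=> x; move: t; apply: (polymap_eq charK0) => // [|n].
    exact: (polymap_lin (lfun_linear _)).
  by have /hopf_morphismP[] := hn n.
Qed.

(** The polynomial identity U^t U^t U = U^(2t+1), at t = -1/2. *)
Lemma unipow_sqrt (D : 'End(H)) M : D ^+ M = 0 ->
  unipow D M (- 2^-1) * unipow D M (- 2^-1) * (1 + D) = 1.
Proof.
move=> DM; have pu := polymap_unipow D M; have uE := unipow_nat charK0 DM.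
have mb := mul_bilin 'End(H).
have /(_ (- 2^-1)) : forall t,
    unipow D M t * unipow D M t * (1 + D) = unipow D M (2 * t + 1).
  apply: (polymap_eq charK0) => [||n].
  - exact: (polymap_bilin mb (polymap_bilin mb pu pu) (polymap_cst _)).
  - exact: polymap_affine.
  - by rewrite -natrM -(natrD _ _ 1%N) !uE -exprD -exprSr addn1 mul2n addnn.
rewrite mulrN divff ?((pcharf0P K).1 charK0) // addNr -[0]/(0%:R) => ->; exact: uE.
Qed.

Lemma unipow_comm (D f : 'End(H)) M t :
  GRing.comm f D -> GRing.comm f (unipow D M t).
Proof.
move=> cfD; apply: commr_sum => k _.
by rewrite /GRing.comm -scalerAl -scalerAr commrX.
Qed.

(** The companion automorphism is phi^((N+1)/2) U^(-1/2) with U = phi^N. It is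
injective because its square is phi, a power of which is the invertible map U. *)
Theorem odd_grouplike_almost_involutive :
  pointed H -> odd (grouplike_order H) -> almost_involutive H.
Proof.
move=> pH; set N := grouplike_order H => oN.
pose phi := sqantipode H; pose D := phi ^+ N - 1; pose M := \dim {:H}.
have UE : 1 + D = phi ^+ N by rewrite addrC subrK.
have DM : D ^+ M = 0.
  apply/lfunP => x; rewrite lfun_expE zero_lfunE.
  rewrite -(iter_sqantipode_unipotent (psi := phi ^+ N) pH _ x); last first.
    by move=> y; rewrite lfun_expE.
  by apply: eq_iter => y; rewrite add_lfunE opp_lfunE id_lfunE.
pose r := unipow D M (- 2^-1).
have rr : r * r * phi ^+ N = 1 by rewrite -UE; apply: unipow_sqrt.
have cr : GRing.comm phi r.
  by apply: unipow_comm; apply: commrB; [exact: commrX | exact: commr1].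
(* N./2.+1 is (N+1)/2 as N is odd *)
pose sigma := phi ^+ N./2.+1 * r.
have hs : hopf_morphism sigma.
  apply: hopf_morphismM; first exact/hopf_morphismX/hopf_morphism_sqantipode.
  apply: hopf_morphism_unipow => //; rewrite UE.
  exact/hopf_morphismX/hopf_morphism_sqantipode.
have ss : sigma * sigma = phi.
  have cX n : phi ^+ n * r = r * phi ^+ n by apply/commr_sym/commrX/commr_sym.
  rewrite /sigma {1}cX -mulrA [_ * (_ * r)]mulrA -exprD cX.
  have -> : (N./2.+1 + N./2.+1)%N = N.+1.
    by rewrite addSn addnS addnn -[in RHS](odd_double_half N) oN.
  by rewrite exprSr !mulrA rr mul1r.
exists sigma; last by rewrite [LHS]lfun_compE ss.
split=> //.
have inj : lker sigma == 0%VS.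
  rewrite -subv0; apply/subvP => x; rewrite memv_ker memv0 => /eqP sx.
  have phx : phi x = 0 by rewrite -ss lfun_mulE sx linear0.
  have -> : x = (r * r * phi ^+ N) x by rewrite rr id_lfunE.
  have -> : r * r * phi ^+ N = phi ^+ N * (r * r).
    have c : GRing.comm phi (r * r) by apply: commrM.
    by rewrite (commrX N (commr_sym c)).
  by rewrite -(prednK (odd_gt0 oN)) exprS -mulrA lfun_mulE phx linear0.
exact: Bijective (lker0_lfunK inj) (lker0_lfunVK inj).
Qed.

End AlmostInvolutive.

Theorem theorem2p4 (K : closedFieldType) (charK0 : [pchar K] =i pred0)
    (H : hopfAlgType K) (pointedH : pointed H) :
  (odd (grouplike_order H) -> almost_involutive H) /\
  (odd (\dim {:H}) -> almost_involutive H).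
Proof.
split=> odd_; apply: odd_grouplike_almost_involutive => //.
exact: dvdn_odd (grouplike_order_dvd_dim pointedH) odd_.
Qed.
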